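(* Let $(\mathcal A,\mathcal B,\mathcal C)$ be a recollement of abelian categories, with functors $i^*,i_*,i^!,j_!,j^*,j_*$, where $\mathcal B$ has enough projectives and enough injectives and the functors $i^!$ and $j_!$ are exact. Let $(\mathcal U_1,\mathcal V_1)$ and $(\mathcal U_3,\mathcal V_3)$ be tilting cotorsion pairs in $\mathcal A$ and $\mathcal C$ respectively, let $(\mathcal U_2,\mathcal V_2)$ be the glued cotorsion pair in $\mathcal B$, and put $\mathcal T_i=\mathcal U_i\cap\mathcal V_i$ for $i=1,2,3$. Assume $\mathcal T_i=\mathrm{add}\,T_i$ for some object $T_i$, for $i=1,3$. Then $(\mathcal U_2,\mathcal V_2)$ is a tilting cotorsion pair, and $\mathcal T_2=\mathrm{add}(i_*T_1\oplus K_{T_3})$, where $K_{T_3}$ is the object of $\mathcal B$ constructed as follows. Write $T_3=\bigoplus_{l=1}^m T_3^l$ with $T_3^l$ indecomposable. For each $l$, choose a short exact sequence $0\to i^!j_!T_3^l\to V_1\to U_1\to 0$ in $\mathcal A$ with $V_1\in\mathcal V_1$ and $U_1\in\mathcal U_1$, and let $K_{T_3^l}$ be the pushout of the counit $i_*i^!j_!T_3^l\to j_!T_3^l$ along the induced morphism $i_*i^!j_!T_3^l\to i_*V_1$. Put $K_{T_3}=\bigoplus_{l=1}^m K_{T_3^l}$.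
   Context: Standing assumptions: all categories are $k$-linear over a field $k$, Hom-finite and Krull–Schmidt. A subcategory means a full subcategory closed under isomorphisms, finite direct sums and direct summands; $\mathrm{add}\,T$ is the subcategory of direct summands of finite direct sums of copies of $T$. A recollement $(\mathcal A,\mathcal B,\mathcal C)$ of abelian categories consists of additive functors $i_*:\mathcal A\to\mathcal B$, $i^*,i^!:\mathcal B\to\mathcal A$, $j^*:\mathcal B\to\mathcal C$, $j_!,j_*:\mathcal C\to\mathcal B$ such that $(i^*,i_*,i^!)$ and $(j_!,j^*,j_* )$ are adjoint triples, $i_*,j_!,j_*$ are fully faithful, and $\mathrm{Im}\, i_*=\mathrm{Ker}\, j^*$. Under the hypotheses of the claim, $\mathcal A$ and $\mathcal C$ also have enough projectives and enough injectives, and for $T''\in\mathcal C$ there is a short exact sequence $0\to i_*i^!j_!T''\to j_!T''\to j_*T''\to0$ given by adjunction morphisms; hence the pushout $K_{T''}$ fits in short exact sequences $0\to i_*V_1\to K_{T''}\to j_*T''\to 0$ and $0\to j_!T''\to K_{T''}\to i_*U_1\to0$. Let $\mathcal E$ be an abelian category with enough projectives $\mathcal P_{\mathcal E}$ and enough injectives. For a subcategory $\mathcal D$: $\mathcal D^{\bot}=\{X\mid\mathrm{Ext}^i_{\mathcal E}(\mathcal D,X)=0\ \forall i>0\}$, ${}^{\bot_1}\mathcal D=\{X\mid \mathrm{Ext}^1_{\mathcal E}(X,\mathcal D)=0\}$. Put $\mathcal D^{\vee}_0=\mathcal D$; for $i\ge1$, $\mathcal D^{\vee}_i$ consists of the $X$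 admitting a short exact sequence $0\to X\to D\to C\to0$ with $D\in\mathcal D$, $C\in\mathcal D^{\vee}_{i-1}$; $\mathcal D^{\vee}=\bigcup_i\mathcal D^{\vee}_i$. A subcategory $\mathcal T$ is $n$-tilting ($n\ge1$) if (P1) all objects of $\mathcal T$ have projective dimension $\le n$; (P2) $\mathrm{Ext}^i_{\mathcal E}(\mathcal T,\mathcal T)=0$ for $i=1,\dots,n$; (P3) every projective $P$ admits short exact sequences $0\to P\to T_0\to R_1\to0$, $0\to R_1\to T_1\to R_2\to0$, …, $0\to R_{n-1}\to T_{n-1}\to T_n\to0$ with all $T_i\in\mathcal T$. Generalized tilting means $n$-tilting for some $n\ge1$. A pair $(\mathcal U,\mathcal V)$ of subcategories is a cotorsion pair if $\mathrm{Ext}^1_{\mathcal E}(\mathcal U,\mathcal V)=0$ and every $B\in\mathcal E$ admits short exact sequences $0\to V_B\to U_B\to B\to0$ and $0\to B\to V^B\to U^B\to0$ with $U_B,U^B\in\mathcal U$, $V_B,V^B\in\mathcal V$. It is hereditary if $\mathrm{Ext}^2_{\mathcal E}(\mathcal U,\mathcal V)=0$. A hereditary cotorsion pair $(\mathcal U,\mathcal V)$ with $\mathcal T=\mathcal U\cap\mathcal V$ is a tilting cotorsion pair if $\mathcal T$ is generalized tilting, $\mathcal U=\mathcal T^{\vee}$ and $\mathcal V=\mathcal T^{\bot}$. Glued cotorsion pair. Given cotorsion pairs $(\mathcal U_1,\mathcal V_1)$ in $\mathcal A$ and $(\mathcal U_3,\mathcal V_3)$ in $\mathcal C$, the glued cotorsion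 pair in $\mathcal B$ is $(\mathcal U_2,\mathcal V_2)$ with $\mathcal V_2=\{B\in\mathcal B\mid i^!B\in\mathcal V_1,\ j^*B\in\mathcal V_3\}$ and $\mathcal U_2={}^{\bot_1}\mathcal V_2$ (this is a cotorsion pair in $\mathcal B$ under the hypotheses on the recollement). *)

(* Defs.v *)
From HB Require Import structures.
From mathcomp Require Import all_boot all_order all_algebra.
From mathcomp Require Import boolp classical_sets.

Set Implicit Arguments.
Unset Strict Implicit.
Unset Printing Implicit Defensive.

Import GRing.Theory.
Local Open Scope classical_set_scope.
Local Open Scope ring_scope.

Declare Scope cat_scope.
Delimit Scope cat_scope with cat.
Reserved Notation "g ∘ f" (at level 40, left associativity).

(** ** Hom-finite linear categories *)

(* The Hom spaces are [vectType]s, i.e. finite-dimensional vector spaces over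
   [k]: Hom-finiteness is part of the structure. *)
Record linCat (k : fieldType) := LinCat {
  obj :> Type;
  hom : obj -> obj -> vectType k;
  idm : forall X, hom X X;
  cmp : forall X Y Z, hom Y Z -> hom X Y -> hom X Z;
  cmp1m : forall X Y (f : hom X Y), cmp (idm Y) f = f;
  cmpm1 : forall X Y (f : hom X Y), cmp f (idm X) = f;
  cmpA : forall W X Y Z (h : hom Y Z) (g : hom X Y) (f : hom W X),
    cmp h (cmp g f) = cmp (cmp h g) f;
  cmp_linl : forall X Y Z a (g g' : hom Y Z) (f : hom X Y),
    cmp (a *: g + g') f = a *: cmp g f + cmp g' f;
  cmp_linr : forall X Y Z a (g : hom Y Z) (f f' : hom X Y),
    cmp g (a *: f + f') = a *: cmp g f + cmp g f'
}.

Arguments hom {k} C X Y : rename.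
Arguments idm {k} {C} X : rename.
Arguments cmp {k} {C} {X Y Z} g f : rename.

Notation "g ∘ f" := (cmp g f) : cat_scope.
Local Open Scope cat_scope.

Section Category.
Context {k : fieldType} {C : linCat k}.
Implicit Types W X Y Z S : C.

Definition is_iso X Y (f : hom C X Y) : Prop :=
  exists g : hom C Y X, g ∘ f = idm X /\ f ∘ g = idm Y.

Definition isomorphic X Y : Prop := exists f : hom C X Y, is_iso f.

Definition mono X Y (f : hom C X Y) : Prop :=
  forall W (u v : hom C W X), f ∘ u = f ∘ v -> u = v.

Definition epi X Y (f : hom C X Y) : Prop :=
  forall Z (u v : hom C Y Z), u ∘ f = v ∘ f -> u = v.

Definition is_zero X : Prop :=
  (forall Y (f : hom C X Y), f = 0) /\ (forall Y (f : hom C Y X), f = 0).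

(* [S] is a direct sum of the finite family [X]; for the empty family this
   says that [S] is a zero object. *)
Definition dsum (I : finType) (X : I -> C) S : Prop :=
  exists (inj : forall i, hom C (X i) S) (prj : forall i, hom C S (X i)),
    [/\ forall i, prj i ∘ inj i = idm (X i),
        forall i j, i != j -> prj j ∘ inj i = 0
      & \sum_(i : I) inj i ∘ prj i = idm S].

Definition dsum2 X Y S : Prop := dsum (fun b : bool => if b then X else Y) S.

Definition summand X S : Prop := exists Y, dsum2 X Y S.

Definition is_kernel X Y Z (f : hom C X Y) (g : hom C Y Z) : Prop :=
  g ∘ f = 0 /\
  forall W (u : hom C W Y), g ∘ u = 0 -> exists! v : hom C W X, f ∘ v = u.

Definition is_cokernel X Y Z (f : hom C X Y) (g : hom C Y Z) : Prop :=
  g ∘ f = 0 /\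
  forall W (u : hom C Y W), u ∘ f = 0 -> exists! v : hom C Z W, v ∘ g = u.

(* 0 -> X -> Y -> Z -> 0 *)
Definition ses X Y Z (f : hom C X Y) (g : hom C Y Z) : Prop :=
  is_kernel f g /\ is_cokernel f g.

(* Exactness of X -> Y -> Z at Y: the image of [f] is the kernel of [g]. *)
Definition exact_at X Y Z (f : hom C X Y) (g : hom C Y Z) : Prop :=
  exists N (e : hom C X N) (i : hom C N Y),
    [/\ is_kernel i g, epi e & i ∘ e = f].

Definition is_pushout X Y Z P (f : hom C X Y) (g : hom C X Z)
    (a : hom C Y P) (b : hom C Z P) : Prop :=
  a ∘ f = b ∘ g /\
  forall W (u : hom C Y W) (v : hom C Z W), u ∘ f = v ∘ g ->
    exists! w : hom C P W, w ∘ a = u /\ w ∘ b = v.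

Definition indecomposable X : Prop :=
  ~ is_zero X /\ forall Y Z, dsum2 Y Z X -> is_zero Y \/ is_zero Z.

(* End(X) is a local ring. *)
Definition local_end X : Prop :=
  idm X <> 0 /\
  forall f g : hom C X X, ~ is_iso f -> ~ is_iso g -> ~ is_iso (f + g).

Definition projective P : Prop :=
  forall Y Z (e : hom C Y Z) (f : hom C P Z), epi e ->
    exists h : hom C P Y, e ∘ h = f.

Definition injective_obj I : Prop :=
  forall Y Z (m : hom C Y Z) (f : hom C Y I), mono m ->
    exists h : hom C Z I, h ∘ m = f.

End Category.

Section CategoryProperties.
Context {k : fieldType} (C : linCat k).

Record abelian : Prop := Abelian {
  abelian_zero : exists Z : C, is_zero Z;
  abelian_dsum : forall X Y : C, exists S : C, dsum2 X Y S;
  abelian_ker : forall (X Y : C) (f : hom C X Y),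
    exists (N : C) (i : hom C N X), is_kernel i f;
  abelian_coker : forall (X Y : C) (f : hom C X Y),
    exists (Q : C) (p : hom C Y Q), is_cokernel f p;
  abelian_mono : forall (X Y : C) (f : hom C X Y), mono f ->
    exists (Z : C) (g : hom C Y Z), is_kernel f g;
  abelian_epi : forall (X Y : C) (f : hom C X Y), epi f ->
    exists (Z : C) (g : hom C Z X), is_cokernel g f
}.

Definition krull_schmidt : Prop :=
  forall X : C, exists (n : nat) (Y : 'I_n -> C),
    dsum Y X /\ forall i, local_end (Y i).

Definition enough_projectives : Prop :=
  forall X : C, exists (P : C) (p : hom C P X), projective P /\ epi p.

Definition enough_injectives : Prop :=
  forall X : C, exists (I : C) (i : hom C X I), injective_obj I /\ mono i.

End CategoryProperties.

(** ** Ext, computed from projective resolutions *)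

Section Ext.
Context {k : fieldType} {C : linCat k}.
Implicit Types X Y : C.

Record proj_res X := ProjRes {
  pr_obj : nat -> C;
  pr_d : forall n, hom C (pr_obj n.+1) (pr_obj n);
  pr_aug : hom C (pr_obj 0) X;
  pr_proj : forall n, projective (pr_obj n);
  pr_epi : epi pr_aug;
  pr_exact0 : exact_at (pr_d 0) pr_aug;
  pr_exact : forall n, exact_at (pr_d n.+1) (pr_d n)
}.

Definition cocycle X Y (P : proj_res X) n (f : hom C (pr_obj P n) Y) : Prop :=
  f ∘ pr_d P n = 0.

Definition coboundary X Y (P : proj_res X) n :
    hom C (pr_obj P n) Y -> Prop :=
  match n with
  | 0 => fun f => f = 0
  | m.+1 => fun f => exists g : hom C (pr_obj P m) Y, g ∘ pr_d P m = f
  end.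

(* Ext^n(X, Y) = 0, that is H^n(Hom(P, Y)) = 0 for the projective resolutions P
   of X.  All of them have the same cohomology; this is only meant for
   categories with enough projectives, where one exists. *)
Definition Ext_zero n X Y : Prop :=
  forall (P : proj_res X) (f : hom C (pr_obj P n) Y),
    cocycle f -> coboundary f.

Definition pd_le n X : Prop :=
  exists P : proj_res X, forall i, (n < i)%N -> is_zero (pr_obj P i).

End Ext.

(** ** Subcategories, tilting and cotorsion pairs *)

Section Subcategories.
Context {k : fieldType} {C : linCat k}.
Implicit Types (D T U V : set C).

Record is_subcat D : Prop := IsSubcat {
  subcat_iso : forall X Y : C, isomorphic X Y -> D X -> D Y;
  subcat_dsum : forall (n : nat) (X : 'I_n -> C) (S : C),
    dsum X S -> (forall i, D (X i)) -> D S;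
  subcat_summand : forall X S : C, summand X S -> D S -> D X
}.

Definition add_of (X : C) : set C :=
  [set Y | exists (n : nat) (S : C), dsum (fun _ : 'I_n => X) S /\ summand Y S].

Definition Ext_zero_sets n D D' : Prop :=
  forall X Y : C, D X -> D' Y -> Ext_zero n X Y.

Definition right_perp D : set C :=
  [set X | forall i, (0 < i)%N -> forall Y, D Y -> Ext_zero i Y X].

Definition left_perp1 D : set C :=
  [set X | forall Y, D Y -> Ext_zero 1 X Y].

Fixpoint vee_n D (n : nat) : set C :=
  match n with
  | 0 => D
  | m.+1 => [set X | exists (Y Z : C) (f : hom C X Y) (g : hom C Y Z),
               [/\ ses f g, D Y & vee_n D m Z]]
  end.

Definition vee D : set C := [set X | exists n, vee_n D n X].

(* Unfolding [vee_n T n P] in [tilting_P3] gives precisely the sequences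
   0 -> P -> T_0 -> R_1 -> 0, 0 -> R_1 -> T_1 -> R_2 -> 0, ...,
   0 -> R_(n-1) -> T_(n-1) -> T_n -> 0 with all T_i in T. *)
Record n_tilting (n : nat) T : Prop := NTilting {
  tilting_subcat : is_subcat T;
  tilting_P1 : forall X, T X -> pd_le n X;
  tilting_P2 : forall i, (1 <= i <= n)%N -> Ext_zero_sets i T T;
  tilting_P3 : forall P : C, projective P -> vee_n T n P
}.

Definition generalized_tilting T : Prop :=
  exists n, (1 <= n)%N /\ n_tilting n T.

Record cotorsion_pair U V : Prop := CotorsionPair {
  cotorsion_subcatl : is_subcat U;
  cotorsion_subcatr : is_subcat V;
  cotorsion_Ext1 : Ext_zero_sets 1 U V;
  cotorsion_cover : forall B : C,
    exists (VB UB : C) (f : hom C VB UB) (g : hom C UB B),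
      [/\ ses f g, U UB & V VB];
  cotorsion_hull : forall B : C,
    exists (VB UB : C) (f : hom C B VB) (g : hom C VB UB),
      [/\ ses f g, V VB & U UB]
}.

Definition hereditary U V : Prop := Ext_zero_sets 2 U V.

Record tilting_cotorsion_pair U V : Prop := TiltingCotorsionPair {
  tcp_cotorsion : cotorsion_pair U V;
  tcp_hereditary : hereditary U V;
  tcp_tilting : generalized_tilting (U `&` V);
  tcp_left : U = vee (U `&` V);
  tcp_right : V = right_perp (U `&` V)
}.

End Subcategories.

(** ** Additive functors and recollements *)

Record functor {k : fieldType} (C D : linCat k) := Functor {
  fobj :> C -> D;
  fmap : forall X Y : C, hom C X Y -> hom D (fobj X) (fobj Y);
  fmap1 : forall X : C, fmap (idm X) = idm (fobj X);
  fmap_cmp : forall (X Y Z : C) (g : hom C Y Z) (f : hom C X Y),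
    fmap (g ∘ f) = fmap g ∘ fmap f;
  fmapD : forall (X Y : C) (f g : hom C X Y), fmap (f + g) = fmap f + fmap g
}.

Arguments fmap {k C D} F {X Y} f : rename.

Definition fully_faithful {k : fieldType} {C D : linCat k}
    (F : functor C D) : Prop :=
  forall X Y : C, bijective (fun f : hom C X Y => fmap F f).

Definition exact_functor {k : fieldType} {C D : linCat k}
    (F : functor C D) : Prop :=
  forall (X Y Z : C) (f : hom C X Y) (g : hom C Y Z),
    ses f g -> ses (fmap F f) (fmap F g).

(* [L] is left adjoint to [R]. *)
Record adjunction {k : fieldType} {C D : linCat k}
    (L : functor C D) (R : functor D C) := Adjunction {
  adj_unit : forall X : C, hom C X (R (L X));
  adj_counit : forall Y : D, hom D (L (R Y)) Y;
  unit_nat : forall (X X' : C) (f : hom C X X'),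
    adj_unit X' ∘ f = fmap R (fmap L f) ∘ adj_unit X;
  counit_nat : forall (Y Y' : D) (g : hom D Y Y'),
    g ∘ adj_counit Y = adj_counit Y' ∘ fmap L (fmap R g);
  triangleL : forall X : C, adj_counit (L X) ∘ fmap L (adj_unit X) = idm (L X);
  triangleR : forall Y : D, fmap R (adj_counit Y) ∘ adj_unit (R Y) = idm (R Y)
}.

(* [i_us], [i_ls], [i_sh], [j_ls], [j_us], [j_sh] stand for i^*, i_*, i^!,
   j_*, j^*, j_!. *)
Record recollement {k : fieldType} (A B C : linCat k) := Recollement {
  i_ls : functor A B;
  i_us : functor B A;
  i_sh : functor B A;
  j_us : functor B C;
  j_sh : functor C B;
  j_ls : functor C B;
  adj_ius_ils : adjunction i_us i_ls;
  adj_ils_ish : adjunction i_ls i_sh;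
  adj_jsh_jus : adjunction j_sh j_us;
  adj_jus_jls : adjunction j_us j_ls;
  ff_ils : fully_faithful i_ls;
  ff_jsh : fully_faithful j_sh;
  ff_jls : fully_faithful j_ls;
  im_ils_ker_jus : forall Y : B,
    (exists X : A, isomorphic (i_ls X) Y) <-> is_zero (j_us Y)
}.

Section Gluing.
Context {k : fieldType} {A B C : linCat k} (r : recollement A B C).

Definition glued_V (V1 : set A) (V3 : set C) : set B :=
  [set Y | V1 (i_sh r Y) /\ V3 (j_us r Y)].

Definition glued_U (V1 : set A) (V3 : set C) : set B :=
  left_perp1 (glued_V V1 V3).

(* [K] is obtained from [T'' : C] by choosing an exact sequence
   0 -> i^! j_! T'' -> V -> U -> 0 with [V] in [V1] and [U] in [U1], and pushing
   out the counit i_* i^! j_! T'' -> j_! T'' along i_* i^! j_! T'' -> i_* V. *)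
Definition is_glued_obj (U1 V1 : set A) (T'' : C) (K : B) : Prop :=
  exists (V U : A) (f : hom A (i_sh r (j_sh r T'')) V) (g : hom A V U)
    (a : hom B (j_sh r T'') K) (b : hom B (i_ls r V) K),
    [/\ ses f g, V1 V, U1 U
      & is_pushout (adj_counit (adj_ils_ish r) (j_sh r T'')) (fmap (i_ls r) f) a b].

End Gluing.

(* Main.v *)
(* Everything about Ext reduces to Ext^1: for presentations W -> P -> X and
   Y -> I -> Z with P projective and I injective one has
   Ext^n(W, Y) = Ext^(n+1)(X, Y) = Ext^n(X, Z), so the dimension shifts and long
   exact sequences that are needed follow by induction.

   A cotorsion pair (U, V) with Ext^i(U, V) = 0 for all i > 0 and U of bounded
   projective dimension is tilting: iterating V-hulls of an object of U gives a
   coresolution by U & V that eventually splits.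

   In the recollement, exactness of i^! forces j_* to be exact and gives
   0 -> i_* i^! Y -> Y -> j_* j^* Y -> 0.  A hull of B is built by pushing out
   along j_! of a V3-hull of j^* B, then along i_* of a V1-hull of i^! of the
   result; its cokernel is an extension of i_* U1 by j_! U3, so Ext(-, V2) and
   the projective dimension of U2 are controlled by adjunction.

   For X in T2, the object j^* X lies in add T3.  Lifting through the
   surjections X -> j_* j^* X and K -> j_* T3, whose kernels lie in i_* V1, gives
   an endomorphism e of X that factors through copies of K, with 1 - e landing in
   i_* i^! X; then 1 - e factors through a U1-cover of i^! X, which lies in T1. *)

Require Import Defs.
From HB Require Import structures.
From mathcomp Require Import all_boot all_order all_algebra.
From mathcomp Require Import boolp classical_sets.
Import Defs.

Set Implicit Arguments.
Unset Strict Implicit.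
Unset Printing Implicit Defensive.

Import GRing.Theory.
Local Open Scope classical_set_scope.
Local Open Scope ring_scope.
Local Open Scope cat_scope.

(** * Linear and abelian categories *)

Section Linear.
Context {k : fieldType} {C : linCat k}.
Implicit Types W X Y Z S P : C.

Lemma cmpDl X Y Z (g g' : hom C Y Z) (f : hom C X Y) :
  (g + g') ∘ f = g ∘ f + g' ∘ f.
Proof. by have := cmp_linl 1 g g' f; rewrite !scale1r. Qed.

Lemma cmpDr X Y Z (g : hom C Y Z) (f f' : hom C X Y) :
  g ∘ (f + f') = g ∘ f + g ∘ f'.
Proof. by have := cmp_linr 1 g f f'; rewrite !scale1r. Qed.

Lemma cmp0m X Y Z (f : hom C X Y) : (0 : hom C Y Z) ∘ f = 0.
Proof. by apply: (addrI (0 ∘ f)); rewrite -cmpDl !addr0. Qed.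

Lemma cmpm0 X Y Z (g : hom C Y Z) : g ∘ (0 : hom C X Y) = 0.
Proof. by apply: (addrI (g ∘ 0)); rewrite -cmpDr !addr0. Qed.

Lemma cmpNl X Y Z (g : hom C Y Z) (f : hom C X Y) : (- g) ∘ f = - (g ∘ f).
Proof. by apply: (addrI (g ∘ f)); rewrite -cmpDl !subrr cmp0m. Qed.

Lemma cmpNr X Y Z (g : hom C Y Z) (f : hom C X Y) : g ∘ (- f) = - (g ∘ f).
Proof. by apply: (addrI (g ∘ f)); rewrite -cmpDr !subrr cmpm0. Qed.

Lemma cmpBl X Y Z (g g' : hom C Y Z) (f : hom C X Y) :
  (g - g') ∘ f = g ∘ f - g' ∘ f.
Proof. by rewrite cmpDl cmpNl. Qed.

Lemma cmpBr X Y Z (g : hom C Y Z) (f f' : hom C X Y) :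
  g ∘ (f - f') = g ∘ f - g ∘ f'.
Proof. by rewrite cmpDr cmpNr. Qed.

Lemma cmp_suml X Y Z (I : finType) (g : I -> hom C Y Z) (f : hom C X Y) :
  (\sum_i g i) ∘ f = \sum_i g i ∘ f.
Proof.
apply: (big_morph (fun h => h ∘ f)); last exact: cmp0m.
by move=> u v; rewrite cmpDl.
Qed.

Lemma cmp_sumr X Y Z (I : finType) (g : hom C Y Z) (f : I -> hom C X Y) :
  g ∘ (\sum_i f i) = \sum_i g ∘ f i.
Proof.
apply: (big_morph (fun h => g ∘ h)); last exact: cmpm0.
by move=> u v; rewrite cmpDr.
Qed.

Lemma mono0P X Y (f : hom C X Y) :
  mono f <-> forall W (u : hom C W X), f ∘ u = 0 -> u = 0.
Proof.
split=> [fm W u fu0|f0 W u v fuv]; first by apply: fm; rewrite cmpm0.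
by apply/eqP; rewrite -subr_eq0; apply/eqP/f0; rewrite cmpBr fuv subrr.
Qed.

Lemma epi0P X Y (f : hom C X Y) :
  epi f <-> forall Z (u : hom C Y Z), u ∘ f = 0 -> u = 0.
Proof.
split=> [fe Z u uf0|f0 Z u v ufv]; first by apply: fe; rewrite cmp0m.
by apply/eqP; rewrite -subr_eq0; apply/eqP/f0; rewrite cmpBl ufv subrr.
Qed.

Lemma mono_cmp X Y Z (g : hom C Y Z) (f : hom C X Y) :
  mono g -> mono f -> mono (g ∘ f).
Proof. by move=> gm fm W u v; rewrite -!cmpA => /gm /fm. Qed.

Lemma epi_cmp X Y Z (g : hom C Y Z) (f : hom C X Y) :
  epi g -> epi f -> epi (g ∘ f).
Proof. by move=> ge fe W u v; rewrite !cmpA => /fe /ge. Qed.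

Lemma mono_of_cmp X Y Z (g : hom C Y Z) (f : hom C X Y) :
  mono (g ∘ f) -> mono f.
Proof. by move=> gfm W u v fuv; apply: gfm; rewrite -!cmpA fuv. Qed.

Lemma epi_of_cmp X Y Z (g : hom C Y Z) (f : hom C X Y) :
  epi (g ∘ f) -> epi g.
Proof. by move=> gfe W u v ugv; apply: gfe; rewrite !cmpA ugv. Qed.

Lemma retraction_epi X Y (g : hom C Y X) (f : hom C X Y) :
  g ∘ f = idm X -> epi g.
Proof. by move=> gf Z u v ugv; rewrite -[u]cmpm1 -[v]cmpm1 -gf !cmpA ugv. Qed.

Lemma section_mono X Y (g : hom C Y X) (f : hom C X Y) :
  g ∘ f = idm X -> mono f.
Proof. by move=> gf Z u v ugv; rewrite -[u]cmp1m -[v]cmp1m -gf -!cmpA ugv. Qed.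

Lemma iso_epi X Y (f : hom C X Y) : is_iso f -> epi f.
Proof. by case=> g [_ fg]; apply: retraction_epi fg. Qed.

Lemma iso_mono X Y (f : hom C X Y) : is_iso f -> mono f.
Proof. by case=> g [gf _]; apply: section_mono gf. Qed.

Lemma iso_cmp_epi X Y Z (g : hom C Y Z) (f : hom C X Y) :
  is_iso g -> epi (g ∘ f) -> epi f.
Proof.
move=> [g' [g'g _]] gfe W u v uv; rewrite -[u]cmpm1 -[v]cmpm1 -g'g !cmpA.
by congr (_ ∘ g); apply: gfe; rewrite !cmpA -!(cmpA _ g') g'g !cmpm1.
Qed.

Lemma isomorphic_refl X : isomorphic X X.
Proof. by exists (idm X), (idm X); rewrite cmp1m. Qed.

Lemma isomorphic_sym X Y : isomorphic X Y -> isomorphic Y X.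
Proof. by case=> f [g [gf fg]]; exists g, f. Qed.

Lemma zeroP X : is_zero X <-> idm X = 0.
Proof.
split=> [[X0 _]|X0]; first exact: X0.
by split=> Y f; [rewrite -[f]cmpm1 X0 cmpm0|rewrite -[f]cmp1m X0 cmp0m].
Qed.

Lemma zero_epi X Y (f : hom C X Y) : is_zero X -> epi f -> is_zero Y.
Proof.
move=> X0 /epi0P fe; apply/zeroP; apply: fe; rewrite cmp1m.
by case: X0 => + _; apply.
Qed.

Lemma ker_eq0 X Y Z (f : hom C X Y) (g : hom C Y Z) :
  is_kernel f g -> g ∘ f = 0.
Proof. by case. Qed.

Lemma ker_fac X Y Z (f : hom C X Y) (g : hom C Y Z) W (u : hom C W Y) :
  is_kernel f g -> g ∘ u = 0 -> exists v : hom C W X, f ∘ v = u.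
Proof. by case=> _ H /H[v [fv _]]; exists v. Qed.

Lemma ker_mono X Y Z (f : hom C X Y) (g : hom C Y Z) : is_kernel f g -> mono f.
Proof.
move=> [gf0 H]; apply/mono0P => W u fu0.
have [|v [_ vu]] := H W 0; first by rewrite cmpm0.
by rewrite -(vu u fu0) (vu 0) // cmpm0.
Qed.

Lemma ker_intro X Y Z (f : hom C X Y) (g : hom C Y Z) :
  g ∘ f = 0 -> mono f ->
  (forall W (u : hom C W Y), g ∘ u = 0 -> exists v : hom C W X, f ∘ v = u) ->
  is_kernel f g.
Proof.
move=> gf0 fm H; split=> // W u /H[v fv]; exists v; split=> // v' fv'.
by apply: fm; rewrite fv.
Qed.

Lemma cok_eq0 X Y Z (f : hom C X Y) (g : hom C Y Z) :
  is_cokernel f g -> g ∘ f = 0.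
Proof. by case. Qed.

Lemma cok_fac X Y Z (f : hom C X Y) (g : hom C Y Z) W (u : hom C Y W) :
  is_cokernel f g -> u ∘ f = 0 -> exists v : hom C Z W, v ∘ g = u.
Proof. by case=> _ H /H[v [fv _]]; exists v. Qed.

Lemma cok_epi X Y Z (f : hom C X Y) (g : hom C Y Z) : is_cokernel f g -> epi g.
Proof.
move=> [gf0 H]; apply/epi0P => W u ug0.
have [|v [_ vu]] := H W 0; first by rewrite cmp0m.
by rewrite -(vu u ug0) (vu 0) // cmp0m.
Qed.

Lemma cok_intro X Y Z (f : hom C X Y) (g : hom C Y Z) :
  g ∘ f = 0 -> epi g ->
  (forall W (u : hom C Y W), u ∘ f = 0 -> exists v : hom C Z W, v ∘ g = u) ->
  is_cokernel f g.
Proof.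
move=> gf0 fm H; split=> // W u /H[v fv]; exists v; split=> // v' fv'.
by apply: fm; rewrite fv.
Qed.

Section Ses.
Context {X Y Z : C} {f : hom C X Y} {g : hom C Y Z}.
Hypothesis fg : ses f g.

Lemma ses_eq0 : g ∘ f = 0. Proof. exact: ker_eq0 fg.1. Qed.
Lemma ses_mono : mono f. Proof. exact: ker_mono fg.1. Qed.
Lemma ses_epi : epi g. Proof. exact: cok_epi fg.2. Qed.

Lemma ses_lift W (u : hom C W Y) : g ∘ u = 0 -> exists v : hom C W X, f ∘ v = u.
Proof. exact: ker_fac fg.1. Qed.

Lemma ses_desc W (u : hom C Y W) : u ∘ f = 0 -> exists v : hom C Z W, v ∘ g = u.
Proof. exact: cok_fac fg.2. Qed.

Lemma ses_section (r : hom C Y X) : r ∘ f = idm X -> exists s, g ∘ s = idm Z.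
Proof.
move=> rf; have [|s sg] := @ses_desc _ (idm Y - f ∘ r).
  by rewrite cmpBl cmp1m -cmpA rf cmpm1 subrr.
exists s; apply: ses_epi; rewrite -cmpA sg cmpBr cmpA ses_eq0 cmp0m.
by rewrite cmpm1 subr0 cmp1m.
Qed.

Lemma ses_retraction (s : hom C Z Y) : g ∘ s = idm Z -> exists r, r ∘ f = idm X.
Proof.
move=> gs; have [|r fr] := @ses_lift _ (idm Y - s ∘ g).
  by rewrite cmpBr cmpm1 cmpA gs cmp1m subrr.
exists r; apply: ses_mono; rewrite cmpA fr cmpBl -cmpA ses_eq0 cmpm0.
by rewrite cmp1m subr0 cmpm1.
Qed.

End Ses.

Lemma dsum2P X Y S : dsum2 X Y S <->
  exists (i1 : hom C X S) (i2 : hom C Y S) (p1 : hom C S X) (p2 : hom C S Y),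
  [/\ p1 ∘ i1 = idm X, p2 ∘ i2 = idm Y, p2 ∘ i1 = 0, p1 ∘ i2 = 0
    & i1 ∘ p1 + i2 ∘ p2 = idm S].
Proof.
split=> [[i [p [pi1 pi0 ip]]]|[i1 [i2 [p1 [p2 [e1 e2 e3 e4 e5]]]]]].
  exists (i true), (i false), (p true), (p false); split.
  - exact: pi1 true.
  - exact: pi1 false.
  - exact: pi0 true false isT.
  - exact: pi0 false true isT.
  - by rewrite -ip big_bool.
exists (fun b => match b return hom C (if b then X else Y) S with
                 | true => i1 | false => i2 end),
       (fun b => match b return hom C S (if b then X else Y) with
                 | true => p1 | false => p2 end).
by split=> [[]|[] []|] //; rewrite big_bool.
Qed.

(** A complement-free form of [summand], immediately preserved by functors; [retract_summand]
    recovers the complement in an abelian category. *)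
Definition retract X S : Prop :=
  exists (s : hom C X S) (r : hom C S X), r ∘ s = idm X.

Lemma summand_retract X S : summand X S -> retract X S.
Proof. by case=> Y /dsum2P[i1 [_ [p1 [_ [e _ _ _ _]]]]]; exists i1, p1. Qed.

Lemma iso_retract X S : isomorphic S X -> retract X S.
Proof. by case=> f [g [_ fg]]; exists g, f. Qed.

End Linear.

(** * Short exact sequences, finite direct sums and pushouts in abelian categories *)

Section Abelian.
Context {k : fieldType} {C : linCat k}.
Context (abC : abelian C).
Implicit Types W X Y Z S P : C.

(** The monomorphism [f] is the kernel of some [g'], and [g'] factors through the cokernel [g], so
    whatever [g] kills is killed by [g']. *)
Lemma mono_cok_ker X Y Z (f : hom C X Y) (g : hom C Y Z) :
  mono f -> is_cokernel f g -> is_kernel f g.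
Proof.
move=> fm cg; apply: ker_intro => //; first exact: cok_eq0 cg.
have [Z' [g' kf]] := abelian_mono abC fm.
have [h hg] := cok_fac cg (ker_eq0 kf).
by move=> W u gu; apply: (ker_fac kf); rewrite -hg -cmpA gu cmpm0.
Qed.

Lemma epi_ker_cok X Y Z (f : hom C X Y) (g : hom C Y Z) :
  epi g -> is_kernel f g -> is_cokernel f g.
Proof.
move=> ge kf; apply: cok_intro => //; first exact: ker_eq0 kf.
have [X' [f' cg]] := abelian_epi abC ge.
have [h fh] := ker_fac kf (cok_eq0 cg).
by move=> W u uf; apply: (cok_fac cg); rewrite -fh cmpA uf cmp0m.
Qed.

Lemma ses_of_mono X Y (f : hom C X Y) :
  mono f -> exists (Z : C) (g : hom C Y Z), ses f g.
Proof.
move=> fm; have [Z [g cg]] := abelian_coker abC f.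
by exists Z, g; split=> //; apply: mono_cok_ker.
Qed.

Lemma ses_of_epi Y Z (g : hom C Y Z) :
  epi g -> exists (X : C) (f : hom C X Y), ses f g.
Proof.
move=> ge; have [X [f kf]] := abelian_ker abC g.
by exists X, f; split=> //; apply: epi_ker_cok.
Qed.

Lemma epi_mono_iso X Y (f : hom C X Y) : epi f -> mono f -> is_iso f.
Proof.
move=> fe fm; have [Z [g kf]] := abelian_mono abC fm.
have g0 : g = 0 by apply: fe; rewrite (ker_eq0 kf) cmp0m.
have [|h fh] := @ker_fac _ _ _ _ _ _ _ _ (idm Y) kf; first by rewrite g0 cmp0m.
by exists h; split=> //; apply: fm; rewrite cmpA fh cmp1m cmpm1.
Qed.

Lemma retract_summand X S : retract X S -> summand X S.
Proof.
case=> s [r rs]; have [Y [i kri]] := ses_of_epi (retraction_epi rs).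
have [|q iq] := @ses_lift _ _ _ _ _ _ _ kri _ (idm S - s ∘ r).
  by rewrite cmpBr cmpm1 cmpA rs cmp1m subrr.
have im := ses_mono kri.
exists Y; apply/dsum2P; exists s, i, r, q; split=> //.
- apply: im; rewrite cmpA iq cmpBl cmp1m -cmpA (ses_eq0 kri) cmpm0.
  by rewrite subr0 cmpm1.
- by apply: im; rewrite cmpA iq cmpBl cmp1m -cmpA rs !cmpm1 subrr cmpm0.
- exact: ses_eq0 kri.
- by rewrite iq addrC subrK.
Qed.

Lemma dsum_exists (I : finType) (X : I -> C) : exists S, dsum X S.
Proof.
suff H (s : seq I) : uniq s -> exists (S : C) (inj : forall i, hom C (X i) S)
    (prj : forall i, hom C S (X i)),
    [/\ forall i, i \in s -> prj i ∘ inj i = idm (X i),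
        forall i j, i \in s -> i != j -> prj j ∘ inj i = 0
      & \sum_(i <- s) inj i ∘ prj i = idm S].
  have [|S [inj [prj [e1 e2 e3]]]] := H (index_enum I).
    exact: index_enum_uniq.
  exists S, inj, prj; split=> // [i|i j]; first by apply: e1; rewrite mem_index_enum.
  by apply: e2; rewrite mem_index_enum.
elim: s => [_|i0 s IH /= /andP[i0s us]].
  have [Z Z0] := abelian_zero abC; exists Z, (fun=> 0), (fun=> 0); split=> //.
  by rewrite big_nil; apply/esym/zeroP.
have [S [inj [prj [e1 e2 e3]]]] := IH us.
have [T /dsum2P[a [b [p [q [pa qb qa pb abT]]]]]] := abelian_dsum abC (X i0) S.
(* [a] has domain [X i0], so it is transported along [i0 = i]. Outside [i0 :: s] the value is 0,
   which makes the orthogonality condition hold for every [j]. *)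
pose inj' i : hom C (X i) T :=
  match i0 =P i with
  | ReflectT e => match e in _ = i return hom C (X i) T with erefl => a end
  | ReflectF _ => if i \in s then b ∘ inj i else 0 end.
pose prj' i : hom C T (X i) :=
  match i0 =P i with
  | ReflectT e => match e in _ = i return hom C T (X i) with erefl => p end
  | ReflectF _ => if i \in s then prj i ∘ q else 0 end.
have inj0 : inj' i0 = a by rewrite /inj'; case: eqP => // e; rewrite (eq_axiomK e).
have prj0 : prj' i0 = p by rewrite /prj'; case: eqP => // e; rewrite (eq_axiomK e).
have injs i : i0 != i -> inj' i = if i \in s then b ∘ inj i else 0.
  by rewrite /inj'; case: eqP.
have prjs i : i0 != i -> prj' i = if i \in s then prj i ∘ q else 0.
  by rewrite /prj'; case: eqP.
have sn i : i \in s -> i0 != i by move=> si; apply: contraNneq i0s => ->.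
exists T, inj', prj'; split.
- move=> i; rewrite inE; case: (eqVneq i0 i) => [<- _|ni]; first by rewrite inj0 prj0.
  rewrite /= => si; rewrite injs // prjs // si -cmpA (cmpA q).
  by rewrite qb cmp1m e1.
- move=> i j; rewrite inE; case: (eqVneq i0 i) => [<- _ nj|ni].
    rewrite inj0 prjs //; case: ifP => _; last exact: cmp0m.
    by rewrite -cmpA qa cmpm0.
  rewrite /= => si nij; rewrite injs // si.
  case: (eqVneq i0 j) => [<-|nj]; first by rewrite prj0 cmpA pb cmp0m.
  rewrite prjs //; case: ifP => _; last exact: cmp0m.
  by rewrite -cmpA (cmpA q) qb cmp1m e2.
- rewrite big_cons inj0 prj0 -abT; congr (_ + _).
  transitivity (b ∘ (\sum_(i <- s) inj i ∘ prj i) ∘ q); last by rewrite e3 cmpm1.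
  have bq : {morph (fun h => b ∘ h ∘ q) : u v / u + v} by move=> u v; rewrite cmpDr cmpDl.
  rewrite (big_morph _ bq (id1 := 0)); last by rewrite cmpm0 cmp0m.
  rewrite !big_seq; apply: eq_bigr => i si.
  by rewrite injs ?prjs ?sn // si !cmpA.
Qed.

(* [P] is the cokernel of [(f, -g)] from [X] to the direct sum of [Y] and [Z]. *)
Lemma pushout_exists X Y Z (f : hom C X Y) (g : hom C X Z) :
  exists (P : C) (a : hom C Y P) (b : hom C Z P),
    is_pushout f g a b /\ (mono f -> mono b).
Proof.
have [S /dsum2P[i1 [i2 [p1 [p2 [e1 e2 e3 e4 e5]]]]]] := abelian_dsum abC Y Z.
pose m := i1 ∘ f - i2 ∘ g.
have [P [q cq]] := abelian_coker abC m.
have p1m : p1 ∘ m = f by rewrite cmpBr !cmpA e1 e4 cmp1m cmp0m subr0.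
have p2m : p2 ∘ m = - g by rewrite cmpBr !cmpA e2 e3 cmp1m cmp0m add0r.
exists P, (q ∘ i1), (q ∘ i2); split; first split.
- by apply/eqP; rewrite -subr_eq0 -!cmpA -cmpBr (cok_eq0 cq).
- move=> W u v uv; have [|w wq] := @cok_fac _ _ _ _ _ _ _ _ (u ∘ p1 + v ∘ p2) cq.
    by rewrite cmpDl -!cmpA p1m p2m cmpNr uv subrr.
  exists w; split; first by rewrite !cmpA wq !cmpDl -!cmpA e1 e2 e3 e4
     !cmpm1 !cmpm0 addr0 add0r.
  move=> w' [w1 w2]; apply: (cok_epi cq); rewrite wq -w1 -w2.
  by rewrite -!cmpA -!cmpDr e5 cmpm1.
- move=> fm; have mm : mono m by apply: (@mono_of_cmp _ _ _ _ _ p1); rewrite p1m.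
  apply/mono0P => W u; rewrite -cmpA => /(ker_fac (mono_cok_ker mm cq))[v mv].
  have v0 : v = 0.
    by apply: fm; rewrite cmpm0 -p1m -cmpA mv cmpA e4 cmp0m.
  by rewrite -[u]cmp1m -e2 -cmpA -mv v0 !cmpm0.
Qed.

Lemma pushout_ses X Y Z X' E (f : hom C X Y) (p : hom C Y Z) (g : hom C X X')
    (a : hom C Y E) (b : hom C X' E) :
  ses f p -> is_pushout f g a b ->
  exists q : hom C E Z, ses b q /\ q ∘ a = p.
Proof.
move=> fp [abE H].
have [|q [[qa qb] qu]] := H Z p 0; first by rewrite cmp0m (ses_eq0 fp).
exists q; split=> //.
(* The pushout constructed in [pushout_exists] has a monic leg [b'], and by universality [b']
   factors through [b]. *)
have bm : mono b.
  have [E' [a' [b' [[ab' _] /(_ (ses_mono fp)) bm']]]] := pushout_exists f g.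
  have [w [[_ wb] _]] := H _ _ _ ab'.
  by apply: (@mono_of_cmp _ _ _ _ _ w); rewrite wb.
suff cq : is_cokernel b q by split=> //; apply: mono_cok_ker.
apply: cok_intro => //.
  by apply: (@epi_of_cmp _ _ _ _ _ _ a); rewrite qa; apply: ses_epi fp.
move=> W u ub; have [|v vp] := @ses_desc _ _ _ _ _ _ _ fp _ (u ∘ a).
  by rewrite -cmpA abE cmpA ub cmp0m.
exists v; have [|w [_ wu]] := H W (u ∘ a) (u ∘ b); first by rewrite -!cmpA abE.
by rewrite -(wu u) // (wu (v ∘ q)) // -!cmpA qa qb cmpm0 ub.
Qed.

Lemma ses_pushout X Y Z X' (f : hom C X Y) (p : hom C Y Z) (g : hom C X X') :
  ses f p -> exists (E : C) (a : hom C Y E) (b : hom C X' E) (q : hom C E Z),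
    [/\ is_pushout f g a b, ses b q & q ∘ a = p].
Proof.
move=> fp; have [E [a [b [po _]]]] := pushout_exists f g.
by have [q [bq qa]] := pushout_ses fp po; exists E, a, b, q.
Qed.

(** [F] is the pushout of [b] along [p]; it realises the cokernel of [b ∘ a] as an extension of the
    two cokernels. *)
Lemma ses_cmp X Y Z P Q (a : hom C X Y) (p : hom C Y P) (b : hom C Y Z)
    (q : hom C Z Q) : ses a p -> ses b q ->
  exists (F : C) (c : hom C Z F) (u : hom C P F) (v : hom C F Q),
    ses (b ∘ a) c /\ ses u v.
Proof.
move=> ap bq; have [F [c [u [v [[cb H] uv vc]]]]] := ses_pushout p bq.
exists F, c, u, v; split=> //.
have bam : mono (b ∘ a) by apply: mono_cmp; [apply: ses_mono bq|apply: ses_mono ap].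
suff cc : is_cokernel (b ∘ a) c by split=> //; apply: mono_cok_ker.
apply: cok_intro.
- by rewrite cmpA cb -cmpA (ses_eq0 ap) cmpm0.
- apply/epi0P => W w wc.
  have [|t [_ tu]] := H W 0 0; first by rewrite !cmp0m.
  have wu : w ∘ u = 0 by apply: (ses_epi ap); rewrite -cmpA -cb cmpA wc !cmp0m.
  by rewrite -(tu w) // (tu 0) // !cmp0m.
- move=> W w; rewrite cmpA => /(ses_desc ap)[t tp].
  by have [|s [[sc _] _]] := H W w t; [rewrite tp|exists s].
Qed.

End Abelian.

(** * Vanishing of Ext *)

Section ExtVanishing.
Context {k : fieldType} {C : linCat k}.
Implicit Types W X Y Z S P : C.

(** Vanishing of Ext^1 in Yoneda's form: every extension splits. [Ext1P] compares it with the
    definition by resolutions. *)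
Definition ext1 X Y : Prop :=
  forall (E : C) (i : hom C Y E) (p : hom C E X), ses i p ->
  exists s : hom C X E, p ∘ s = idm X.

(* [extz n X Y] says that [Ext^(n+1)(X, Y) = 0], and [pdz n X] below that
   [Ext^(n+1)(X, -) = 0]: note the shift. *)
Fixpoint extz n X Y : Prop :=
  match n with
  | 0 => ext1 X Y
  | m.+1 => forall (W P : C) (w : hom C W P) (p : hom C P X),
      projective P -> ses w p -> extz m W Y
  end.

Lemma projective_ext1 P Y : projective P -> ext1 P Y.
Proof. by move=> PP E i p ip; apply: PP (ses_epi ip). Qed.

Context (abC : abelian C).

(** The pushout of the sequence along [f] splits, and its retraction composed with [a] extends
    [f]. *)
Lemma ext1_extend W P X Y (w : hom C W P) (p : hom C P X) (f : hom C W Y) :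
  ext1 X Y -> ses w p -> exists g : hom C P Y, g ∘ w = f.
Proof.
move=> XY wp; have [E [a [b [q [[ab _] bq _]]]]] := ses_pushout abC f wp.
have [s qs] := XY _ _ _ bq; have [r rb] := ses_retraction bq qs.
by exists (r ∘ a); rewrite -cmpA ab cmpA rb cmp1m.
Qed.

(** Lift [f ∘ q] to [t] on the projective [P]. On [W] it lands in [Y]; subtracting an extension of
    that map to [P] makes [t] vanish on [W] and descend to [X]. *)
Lemma proj_extend_lift W P X Y E Z (w : hom C W P) (q : hom C P X)
    (i : hom C Y E) (p : hom C E Z) (f : hom C X Z) :
  projective P -> ses w q ->
  (forall g : hom C W Y, exists h : hom C P Y, h ∘ w = g) ->
  ses i p -> exists g : hom C X E, p ∘ g = f.
Proof.
move=> PP wq H ip; have [t pt] := PP _ _ p (f ∘ q) (ses_epi ip).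
have [|u iu] := @ses_lift _ _ _ _ _ _ _ ip _ (t ∘ w).
  by rewrite cmpA pt -cmpA (ses_eq0 wq) cmpm0.
have [h hw] := H u; have [|g gq] := @ses_desc _ _ _ _ _ _ _ wq _ (t - i ∘ h).
  by rewrite cmpBl -cmpA hw iu subrr.
exists g; apply: (ses_epi wq).
by rewrite -cmpA gq cmpBr pt cmpA (ses_eq0 ip) cmp0m subr0.
Qed.

Lemma proj_extend_ext1 W P X Y (w : hom C W P) (q : hom C P X) :
  projective P -> ses w q ->
  (forall g : hom C W Y, exists h : hom C P Y, h ∘ w = g) -> ext1 X Y.
Proof. by move=> PP wq H E i p; apply: proj_extend_lift PP wq H. Qed.

Lemma inj_lift_ext1 X Y I Z (j : hom C Y I) (q : hom C I Z) :
  injective_obj I -> ses j q ->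
  (forall f : hom C X Z, exists g : hom C X I, q ∘ g = f) -> ext1 X Y.
Proof.
move=> II jq H E i p ip; have [t ti] := II _ _ i j (ses_mono ip).
have [|u up] := @ses_desc _ _ _ _ _ _ _ ip _ (q ∘ t).
  by rewrite -cmpA ti (ses_eq0 jq).
have [h qh] := H u; have [|r jr] := @ses_lift _ _ _ _ _ _ _ jq _ (t - h ∘ p).
  by rewrite cmpBr cmpA qh up subrr.
apply: (ses_section ip (r := r)); apply: (ses_mono jq).
by rewrite cmpA jr cmpBl ti -cmpA (ses_eq0 ip) cmpm0 subr0 cmpm1.
Qed.

Context (epC : enough_projectives C).

Lemma proj_presentation X : exists (W P : C) (w : hom C W P) (p : hom C P X),
  projective P /\ ses w p.
Proof.
have [P [p [PP pe]]] := epC X; have [W [w wp]] := ses_of_epi abC pe.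
by exists W, P, w, p.
Qed.

Lemma ext1_lift X Y E Z (i : hom C Y E) (p : hom C E Z) (f : hom C X Z) :
  ext1 X Y -> ses i p -> exists g : hom C X E, p ∘ g = f.
Proof.
move=> XY ip; have [W [P [w [q [PP wq]]]]] := proj_presentation X.
by apply: (proj_extend_lift f PP wq _ ip) => g; apply: ext1_extend wq.
Qed.

Lemma ext1_summand X S Y : retract X S -> ext1 S Y -> ext1 X Y.
Proof.
move=> [s [r rs]] SY E i p /(ext1_lift r SY)[g pg].
by exists (g ∘ s); rewrite cmpA pg.
Qed.

Lemma ext1_dsum (I : finType) (X : I -> C) S Y :
  dsum X S -> (forall i, ext1 (X i) Y) -> ext1 S Y.
Proof.
move=> [inj [prj [_ _ e]]] XY E i p ip.
have H j : {g : hom C (X j) E | p ∘ g = inj j} by apply/cid/ext1_lift/ip.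
pose g j := sval (H j); have pg j : p ∘ g j = inj j by apply: (svalP (H j)).
exists (\sum_j g j ∘ prj j); rewrite cmp_sumr -e; apply: eq_bigr => j _.
by rewrite cmpA pg.
Qed.

(** This is the exactness of Ext^1(X, Y) -> Ext^1(X, Y'') -> Ext^2(X, Y'), with the last term read
    as Ext^1(W, Y'). *)
Lemma ext1_cosyzygy X Y Y' Y'' W P (w : hom C W P) (q : hom C P X)
    (i : hom C Y' Y) (p : hom C Y Y'') :
  projective P -> ses w q -> ses i p -> ext1 X Y -> ext1 W Y' -> ext1 X Y''.
Proof.
move=> PP wq ip XY WY'; apply: (proj_extend_ext1 PP wq) => f.
have [g pg] := ext1_lift f WY' ip; have [h hw] := ext1_extend g XY wq.
by exists (p ∘ h); rewrite -cmpA hw.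
Qed.

Context (eiC : enough_injectives C).

Lemma inj_presentation Y : exists (I Z : C) (j : hom C Y I) (q : hom C I Z),
  injective_obj I /\ ses j q.
Proof.
have [I [j [II je]]] := eiC Y; have [Z [q jq]] := ses_of_mono abC je.
by exists I, Z, j, q.
Qed.

Section Balance.
Context {W P X Y I Z : C} {w : hom C W P} {p : hom C P X}.
Context {j : hom C Y I} {q : hom C I Z}.
Hypotheses (PP : projective P) (wp : ses w p).
Hypotheses (II : injective_obj I) (jq : ses j q).

(* Both sides compute [Ext^2(X, Y)]. *)
Lemma ext1_balance : ext1 W Y <-> ext1 X Z.
Proof.
split=> H.
  apply: (proj_extend_ext1 PP wp) => f; have [g qg] := ext1_lift f H jq.
  have [h hw] := II g (ses_mono wp).
  by exists (q ∘ h); rewrite -cmpA hw.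
apply: (inj_lift_ext1 II jq) => f; have [g gw] := ext1_extend f H wp.
have [h qh] := PP g (ses_epi jq).
by exists (h ∘ w); rewrite cmpA qh.
Qed.

End Balance.

(** One side depends only on the presentation of [X], the other only on that of [Y], so neither
    depends on choices. This lets [extz_syzygy] replace the universal quantifier in [extz] by a
    single presentation. *)
Lemma extz_balance n W P X Y I Z (w : hom C W P) (p : hom C P X)
    (j : hom C Y I) (q : hom C I Z) :
  projective P -> ses w p -> injective_obj I -> ses j q ->
  extz n W Y <-> extz n X Z.
Proof.
elim: n => [|n IH] in W P X Y I Z w p j q *; first exact: ext1_balance.
move=> PP wp II jq.
have [I' [Z' [j' [q' [II' jq']]]]] := inj_presentation Z.
(* By induction both sides amount to [extz n X Z'], whichever presentation of [X] is taken. *)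
have WZ : extz n W Z <-> extz n.+1 X Z.
  rewrite (IH _ _ _ _ _ _ _ _ _ _ PP wp II' jq'); split.
    by move=> H W' P' w' p' PP' wp'; apply/(IH _ _ _ _ _ _ _ _ _ _ PP' wp' II' jq').
  by move/(_ _ _ _ _ PP wp)/(IH _ _ _ _ _ _ _ _ _ _ PP wp II' jq').
rewrite -WZ; split=> [H|H W' P' w' p' PP' wp'].
  have [W' [P' [w' [p' [PP' wp']]]]] := proj_presentation W.
  by apply/(IH _ _ _ _ _ _ _ _ _ _ PP' wp' II jq)/(H _ _ _ _ PP' wp').
exact/(IH _ _ _ _ _ _ _ _ _ _ PP' wp' II jq).
Qed.

Lemma extz_syzygy n W P X Y (w : hom C W P) (p : hom C P X) :
  projective P -> ses w p -> extz n.+1 X Y <-> extz n W Y.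
Proof.
move=> PP wp; split=> [/(_ _ _ _ _ PP wp)//|WY W' P' w' p' PP' wp'].
have [I [Z [j [q [II jq]]]]] := inj_presentation Y.
apply/(extz_balance n PP' wp' II jq).
exact/(extz_balance n PP wp II jq).
Qed.

Lemma extz_cosyzygy n X Y I Z (j : hom C Y I) (q : hom C I Z) :
  injective_obj I -> ses j q -> extz n.+1 X Y <-> extz n X Z.
Proof.
move=> II jq; have [W [P [w [p [PP wp]]]]] := proj_presentation X.
by rewrite (extz_syzygy _ _ PP wp); apply: extz_balance PP wp II jq.
Qed.

Lemma extz_summand n X S Y : retract X S -> extz n S Y -> extz n X Y.
Proof.
move=> XS; elim: n Y => [|n IH] Y; first exact: ext1_summand.
have [I [Z [j [q [II jq]]]]] := inj_presentation Y.
by rewrite !(extz_cosyzygy _ _ II jq); apply: IH.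
Qed.

Lemma projective_extz n P Y : projective P -> extz n P Y.
Proof.
move=> PP; elim: n Y => [|n IH] Y; first exact: projective_ext1.
have [I [Z [j [q [II jq]]]]] := inj_presentation Y.
exact/(extz_cosyzygy _ _ II jq).
Qed.

(** * Consequences of the long exact sequences of Ext *)

Section LongExactSequence.
Context {X' X X'' : C} {i : hom C X' X} {p : hom C X X''}.
Hypothesis ip : ses i p.

(** Replacing [Y] by a cosyzygy lowers [n] without touching the given sequence, so only Ext^1 needs
    an argument. The same shift serves [extz_sub]; [extz_quotr] takes syzygies of the first variable
    instead. *)
Lemma extz_extension n Y : extz n X' Y -> extz n X'' Y -> extz n X Y.
Proof.
elim: n Y => [|n IH] Y; have [I [Z [j [q [II jq]]]]] := inj_presentation Y;
  last by rewrite !(extz_cosyzygy _ _ II jq); apply: IH.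
move=> X'Y X''Y; apply: (inj_lift_ext1 II jq) => f.
have [g qg] := ext1_lift (f ∘ i) X'Y jq; have [h hi] := II _ _ _ g (ses_mono ip).
have [|u up] := @ses_desc _ _ _ _ _ _ _ ip _ (f - q ∘ h).
  by rewrite cmpBl -cmpA hi qg subrr.
have [v qv] := ext1_lift u X''Y jq; exists (v ∘ p + h).
by rewrite cmpDr cmpA qv up subrK.
Qed.

Lemma extz_sub n Y : extz n X Y -> extz n.+1 X'' Y -> extz n X' Y.
Proof.
elim: n Y => [|n IH] Y; have [I [Z [j [q [II jq]]]]] := inj_presentation Y;
  last by rewrite !(extz_cosyzygy _ _ II jq); apply: IH.
rewrite !(extz_cosyzygy _ _ II jq) => XY X''Z; apply: (inj_lift_ext1 II jq) => f.
have [g gi] := ext1_extend f X''Z ip; have [h qh] := ext1_lift g XY jq.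
by exists (h ∘ i); rewrite cmpA qh.
Qed.

Lemma extz_quotr n Y : extz n Y X -> extz n.+1 Y X' -> extz n Y X''.
Proof.
elim: n Y => [|n IH] Y; have [W [P [w [q [PP wq]]]]] := proj_presentation Y;
  last by rewrite !(extz_syzygy _ _ PP wq); apply: IH.
by rewrite !(extz_syzygy _ _ PP wq); apply: ext1_cosyzygy PP wq ip.
Qed.

End LongExactSequence.

Definition pdz n X : Prop := forall Y, extz n X Y.

Lemma pdzS n X : pdz n X -> pdz n.+1 X.
Proof.
move=> H Y; have [I [Z [j [q [II jq]]]]] := inj_presentation Y.
exact/(extz_cosyzygy _ _ II jq).
Qed.

Lemma pdz_leq m n X : (m <= n)%N -> pdz m X -> pdz n X.
Proof. by move=> /subnK <-; elim: (n - m)%N => // d IH /IH /pdzS. Qed.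

Lemma pdz0_projective P : pdz 0 P -> projective P.
Proof.
move=> H Y Z e f ee; have [K [i ie]] := ses_of_epi abC ee.
exact: ext1_lift (H K) ie.
Qed.

End ExtVanishing.

(** * Projective resolutions and the comparison of [extz] with [Ext_zero] *)

Section Resolutions.
Context {k : fieldType} {C : linCat k}.
Implicit Types W X Y Z S P : C.

Lemma exact_at_ses_cmp W Q X Y Z (q : hom C W X) (f : hom C X Y)
    (g : hom C Y Z) (h : hom C Z Q) :
  epi q -> is_kernel f g -> mono h -> exact_at (f ∘ q) (h ∘ g).
Proof.
move=> qe fg hm; exists X, q, f; split=> //; apply: ker_intro.
- by rewrite -cmpA (ker_eq0 fg) cmpm0.
- exact: ker_mono fg.
- by move=> T u; rewrite -cmpA -(cmpm0 _ h) => /hm/(ker_fac fg).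
Qed.

Lemma exact_at_epi W X Y Z (q : hom C W X) (f : hom C X Y) (g : hom C Y Z) :
  epi q -> is_kernel f g -> exact_at (f ∘ q) g.
Proof. by move=> qe fg; exists X, q, f. Qed.

Section Cons.
Context {W P X : C} (w : hom C W P) (p : hom C P X).
Hypotheses (PP : projective P) (wp : ses w p).
Variable R : proj_res W.

Definition cons_obj n := if n is m.+1 then pr_obj R m else P.

Definition cons_d n : hom C (cons_obj n.+1) (cons_obj n) :=
  match n return hom C (cons_obj n.+1) (cons_obj n) with
  | 0 => w ∘ pr_aug R
  | m.+1 => pr_d R m
  end.

Lemma cons_exact n : exact_at (cons_d n.+1) (cons_d n).
Proof.
case: n => [|n] /=; last exact: pr_exact.
have [N [e [i [ie ee <-]]]] := pr_exact0 R.
exact: exact_at_ses_cmp (ses_mono wp).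
Qed.

Lemma cons_proj n : projective (cons_obj n).
Proof. by case: n => //= n; apply: pr_proj. Qed.

Definition cons_res : proj_res X :=
  @ProjRes _ _ X cons_obj cons_d p cons_proj (ses_epi wp)
    (exact_at_epi (@pr_epi _ _ _ R) wp.1) cons_exact.

End Cons.

Lemma exact_at_cmp0 X Y Z (f : hom C X Y) (g : hom C Y Z) :
  exact_at f g -> g ∘ f = 0.
Proof. by case=> N [e [i [ig _ <-]]]; rewrite cmpA (ker_eq0 ig) cmp0m. Qed.

Lemma exact_at_mono X Y Z Q (f : hom C X Y) (g : hom C Y Z) (h : hom C Z Q) :
  mono h -> exact_at f (h ∘ g) -> exact_at f g.
Proof.
move=> hm [N [e [i [ig ee ie]]]]; exists N, e, i; split=> //; apply: ker_intro.
- by apply: hm; rewrite cmpA (ker_eq0 ig) cmpm0.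
- exact: ker_mono ig.
- by move=> W u gu; apply: (ker_fac ig); rewrite -cmpA gu cmpm0.
Qed.

Section Tail.
Context {X N : C} (R : proj_res X).
Context (e : hom C (pr_obj R 1) N) (i : hom C N (pr_obj R 0)).
Hypotheses (ia : is_kernel i (pr_aug R)) (ee : epi e) (ie : i ∘ e = pr_d R 0).

Lemma tail_exact0 : exact_at (pr_d R 1) e.
Proof.
by apply: (exact_at_mono (ker_mono ia)); rewrite ie; apply: pr_exact.
Qed.

Definition tail_res : proj_res N :=
  @ProjRes _ _ N (fun n => pr_obj R n.+1) (fun n => pr_d R n.+1) e
    (fun n => @pr_proj _ _ _ R n.+1) ee tail_exact0 (fun n => pr_exact R n.+1).

End Tail.

Lemma projective_retract X P : retract X P -> projective P -> projective X.
Proof.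
move=> [s [r rs]] PP Y Z e f ee; have [h eh] := PP _ _ e (f ∘ r) ee.
by exists (h ∘ s); rewrite cmpA eh -cmpA rs cmpm1.
Qed.

Lemma zero_projective Z : is_zero Z -> projective Z.
Proof. by move=> [Z0 _] X Y e f _; exists 0; rewrite cmpm0 (Z0 _ f). Qed.

Lemma zero_res Z : is_zero Z ->
  exists R : proj_res Z, forall n, is_zero (pr_obj R n).
Proof.
move=> Z0; have [ZL ZR] := Z0.
have i0 X Y (f : hom C X Z) (g : hom C Z Y) : exact_at (0 : hom C Z Z) g.
  exists Z, (idm Z), (idm Z); split; last by rewrite cmp1m; apply: ZR.
    apply: ker_intro; first exact: ZL.
      by apply/mono0P => W u; rewrite cmp1m.
    by move=> W u _; exists u; rewrite cmp1m.
  by apply/epi0P => W u; rewrite cmpm1.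
have e0 : epi (0 : hom C Z Z) by apply/epi0P => W u _; apply: ZL.
by exists (@ProjRes _ _ Z (fun=> Z) (fun=> 0) 0 (fun=> zero_projective Z0) e0
  (i0 Z Z 0 0) (fun=> i0 Z Z 0 0)).
Qed.

Context (abC : abelian C) (epC : enough_projectives C).

Lemma res_exists X : exists R : proj_res X, True.
Proof.
(* A presentation is chosen for all objects at once, so that syzygies can be iterated and the
   presentations spliced. *)
have H1 Y := cid (proj_presentation abC epC Y).
pose syz Y := sval (H1 Y); have H2 Y := cid (svalP (H1 Y)).
pose cov Y := sval (H2 Y); have H3 Y := cid (svalP (H2 Y)).
pose inc Y := sval (H3 Y); have H4' Y := cid (svalP (H3 Y)).
pose aug Y := sval (H4' Y).
have H4 Y : projective (cov Y) /\ ses (inc Y) (aug Y) := svalP (H4' Y).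
pose Om n := iter n syz X.
have aeps Y : epi (aug Y) by apply: ses_epi (H4 Y).2.
have ex n : exact_at (inc (Om n.+1) ∘ aug (Om n.+2)) (inc (Om n) ∘ aug (Om n.+1)).
  exact: (exact_at_ses_cmp _ (H4 (Om n.+1)).2.1 (ses_mono (H4 (Om n)).2)).
by exists (@ProjRes _ _ X (fun n => cov (Om n)) (fun n => inc (Om n) ∘ aug (Om n.+1))
  (aug X) (fun n => (H4 (Om n)).1) (aeps X)
  (exact_at_epi (aeps (syz X)) (H4 X).2.1) ex).
Qed.

Lemma extz_Ext_zero n X Y : extz n X Y -> Ext_zero n.+1 X Y.
Proof.
elim: n X => [|n IH] X XY R f; have [N [e [i [ia ee ie]]]] := pr_exact0 R;
  have ses_ia : ses i (pr_aug R) by split=> //; apply: epi_ker_cok (@pr_epi _ _ _ R) ia.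
  rewrite /cocycle /= => fd.
  (* The cocycle [f] kills the image of the next differential, hence factors through the syzygy [N];
     extending that map from [N] to degree 0 exhibits a coboundary. *)
  have [N' [e' [i' [ie' ee' ied]]]] := tail_exact0 ia ie.
  have [|f' fe] := @cok_fac _ _ _ _ _ _ _ _ f (epi_ker_cok abC ee ie').
    by apply: ee'; rewrite -cmpA ied fd cmp0m.
  have [g gi] := ext1_extend abC f' XY ses_ia.
  by exists g; rewrite -ie cmpA gi fe.
have NY : extz n N Y by apply: (XY _ _ _ _ (@pr_proj _ _ _ R 0) ses_ia).
exact: (IH N NY (tail_res ia ee ie) f).
Qed.

Lemma Ext_zeroP n X Y : Ext_zero n.+1 X Y <-> extz n X Y.
Proof.
split; last exact: extz_Ext_zero.
elim: n X => [|n IH] X XY.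
  have [W [P [w [p [PP wp]]]]] := proj_presentation abC epC X.
  apply: (proj_extend_ext1 PP wp) => f; have [R _] := res_exists W.
  (* In the spliced resolution [f ∘ pr_aug R] is a 1-cocycle, and a cochain bounding it is an
     extension of [f] to [P]. *)
  have [|g gw] := XY (cons_res PP wp R) (f ∘ pr_aug R).
    by rewrite /cocycle /= -cmpA (exact_at_cmp0 (pr_exact0 R)) cmpm0.
  by exists g; apply: (@pr_epi _ _ _ R); rewrite -cmpA.
move=> W P w p PP wp; apply: IH => R f fd.
exact: (XY (cons_res PP wp R) f).
Qed.

Lemma Ext1P X Y : Ext_zero 1 X Y <-> ext1 X Y.
Proof. exact: (Ext_zeroP 0). Qed.

Context (eiC : enough_injectives C).

(** Both directions shift dimension: [tail_res] drops the first term of a resolution and [cons_res]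
    prepends one. *)
Lemma pd_leP n X : pd_le n X <-> pdz n X.
Proof.
split.
  elim: n X => [|n IH] X [R R0]; have [N [e [i [ia ee ie]]]] := pr_exact0 R;
    have ses_ia : ses i (pr_aug R) by split=> //; apply: epi_ker_cok (@pr_epi _ _ _ R) ia.
    move=> Y; apply: projective_ext1.
    (* [N] is a quotient of the degree 1 term, which is zero here; hence the augmentation is an
       isomorphism. *)
    have [_ N0] : is_zero N by apply: zero_epi ee; apply: R0.
    have am : mono (pr_aug R).
      by apply/mono0P => W u /(ker_fac ia)[v <-]; rewrite (N0 _ v) cmpm0.
    apply: projective_retract (@pr_proj _ _ _ R 0); apply: iso_retract.
    by exists (pr_aug R); apply: epi_mono_iso (@pr_epi _ _ _ R) am.
  have pdN : pdz n N by apply: IH; exists (tail_res ia ee ie) => m mn; apply: R0.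
  by move=> Y; apply/(extz_syzygy abC epC eiC _ _ (@pr_proj _ _ _ R 0) ses_ia).
elim: n X => [|n IH] X pdX.
  have PX := pdz0_projective abC epC pdX.
  have [Z Z0] := abelian_zero abC; have [R R0] := zero_res Z0.
  have [ZL ZR] := Z0.
  (* A projective [X] is resolved by itself in degree 0 and by zero objects above. *)
  have zx : ses (0 : hom C Z X) (idm X).
    split.
      apply: ker_intro => [||W u]; first by rewrite cmpm0.
        by apply/mono0P => W u _; apply: ZR.
      by rewrite cmp1m => ->; exists 0; rewrite cmpm0.
    apply: cok_intro => [||W u _]; first by rewrite cmpm0.
      by apply/epi0P => W u; rewrite cmpm1.
    by exists u; rewrite cmpm1.
  exists (cons_res PX zx R) => -[|m] //= _; exact: R0.
have [W [P [w [p [PP wp]]]]] := proj_presentation abC epC X.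
have [|R R0] := IH W; first by move=> Y; apply/(extz_syzygy abC epC eiC _ _ PP wp).
by exists (cons_res PP wp R) => -[|m] //= mn; apply: R0.
Qed.

End Resolutions.

(** * Tilting cotorsion pairs *)

Section Factors.
Context {k : fieldType} {C : linCat k}.
Implicit Types X Y S T : C.

(** These endomorphisms are closed under sums, and by [add_ofP] the identity is one of them exactly
    when [X] lies in add S. Membership can thus be proved by cutting [idm X] into pieces. *)
Definition factors S X (e : hom C X X) : Prop :=
  exists (I : finType) (f : I -> hom C S X) (g : I -> hom C X S),
  \sum_i f i ∘ g i = e.

Lemma factors0 S X : factors S (0 : hom C X X).
Proof. by exists void, (fun=> 0), (fun=> 0); rewrite big1 // => -[]. Qed.

Lemma factorsD S X (e e' : hom C X X) :
  factors S e -> factors S e' -> factors S (e + e').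
Proof.
move=> [I [f [g <-]]] [J [f' [g' <-]]].
exists (I + J)%type, (fun s => match s with inl i => f i | inr j => f' j end),
  (fun s => match s with inl i => g i | inr j => g' j end).
by rewrite big_sumType.
Qed.

Lemma factors_sum (I : finType) S X (e : I -> hom C X X) :
  (forall i, factors S (e i)) -> factors S (\sum_i e i).
Proof.
by move=> H; apply: (big_ind (factors S (X := X))) => //;
  [apply: factors0|apply: factorsD].
Qed.

Lemma factors_cmp S T X (f : hom C T X) (g : hom C X T) :
  factors S (idm T) -> factors S (f ∘ g).
Proof.
move=> [I [a [b ab]]]; exists I, (fun i => f ∘ a i), (fun i => b i ∘ g).
rewrite -[X in f ∘ X]cmp1m -ab cmp_suml cmp_sumr.
by apply: eq_bigr => i _; rewrite !cmpA.
Qed.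

Lemma factors_trans S T X (e : hom C X X) :
  factors S (idm T) -> factors T e -> factors S e.
Proof.
by move=> ST [I [f [g <-]]]; apply: factors_sum => i; apply: factors_cmp.
Qed.

Lemma factors_retract S X : retract X S -> factors S (idm X).
Proof.
by move=> [s [r rs]]; exists unit, (fun=> r), (fun=> s); rewrite big_const card_unit /= addr0.
Qed.

Lemma retract_refl X : retract X X.
Proof. by exists (idm X), (idm X); rewrite cmp1m. Qed.

Lemma dsum_retract (I : finType) (X : I -> C) S i : dsum X S -> retract (X i) S.
Proof. by move=> [inj [prj [e _ _]]]; exists (inj i), (prj i). Qed.

Lemma add_ofP (abC : abelian C) S X : add_of S X <-> factors S (idm X).
Proof.
split=> [[n [T [[inj [prj [_ _ e]]] /summand_retract XT]]]|[I [f [g e]]]].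
  by apply: factors_trans (factors_retract XT); exists 'I_n, inj, prj.
pose F (i : 'I_#|I|) := f (enum_val i); pose G (i : 'I_#|I|) := g (enum_val i).
have [T dT] := dsum_exists abC (fun _ : 'I_#|I| => S).
exists #|I|, T; split=> //; apply: retract_summand => //.
have [inj [prj [e1 e2 _]]] := dT.
exists (\sum_i inj i ∘ G i), (\sum_i F i ∘ prj i).
have -> : idm X = \sum_i F i ∘ G i.
  rewrite -e (reindex (fun i : 'I_#|I| => enum_val i)) //.
  by exists enum_rank => i _; [apply: enum_valK|apply: enum_rankK].
rewrite cmp_suml; apply: eq_bigr => i _; rewrite cmp_sumr (bigD1 i) //= big1 => [|j ji].
  by rewrite addr0 -cmpA (cmpA (prj i)) e1 cmp1m.
by rewrite -cmpA (cmpA (prj i)) e2 ?cmp0m ?cmpm0.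
Qed.

Lemma subcat_retract (D : set C) X S :
  abelian C -> is_subcat D -> retract X S -> D S -> D X.
Proof. by move=> abC sD /(retract_summand abC); apply: subcat_summand. Qed.

Lemma subcat_dsum2 (D : set C) X Y S :
  is_subcat D -> dsum2 X Y S -> D X -> D Y -> D S.
Proof.
move=> sD /dsum2P[i1 [i2 [p1 [p2 [e1 e2 e3 e4 e5]]]]] DX DY.
(* [is_subcat] speaks of families indexed by ordinals and [dsum2] of one indexed by [bool]. *)
pose F (i : 'I_2) := if i == ord0 then X else Y.
pose lst : 'I_2 := ord_max.
apply: (subcat_dsum sD (n := 2) (X := F)); last first.
  by move=> i; rewrite /F; case: ifP.
exists (fun i : 'I_2 => match i == ord0 as b return hom C (if b then X else Y) S with
                        | true => i1 | false => i2 end),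
       (fun i : 'I_2 => match i == ord0 as b return hom C S (if b then X else Y) with
                        | true => p1 | false => p2 end).
split.
- by move=> i; rewrite /F; case: (i == ord0).
- move=> i j ij; rewrite /F.
  case: (eqVneq i ord0) => [ei|ni]; case: (eqVneq j ord0) => [ej|nj] //.
    by rewrite ei ej in ij.
  by case: i j ij ni nj => [[|[|i]] ?] [[|[|j]] ?].
- by rewrite big_ord_recl big_ord1.
Qed.

Lemma subcat_setI (D E : set C) : is_subcat D -> is_subcat E -> is_subcat (D `&` E).
Proof.
move=> sD sE; split.
- by move=> X Y XY [DX EX]; split; [apply: subcat_iso DX|apply: subcat_iso EX].
- move=> n X S XS H; split.
    by apply: subcat_dsum XS _ => // i; case: (H i).
  by apply: subcat_dsum XS _ => // i; case: (H i).
- by move=> X S XS [DS ES]; split; [apply: subcat_summand DS|apply: subcat_summand ES].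
Qed.

Lemma subcat_zero (D : set C) Z : is_subcat D -> is_zero Z -> D Z.
Proof.
move=> sD Z0; have Z1 := Z0; case: Z1 => ZL ZR.
apply: (subcat_dsum sD (n := 0) (X := fun=> Z)) => [|[]//].
exists (fun=> 0), (fun=> 0); split=> [[]//|[]//|].
by rewrite big_ord0; apply/esym/zeroP.
Qed.

Lemma subcat_add_of (abC : abelian C) (D : set C) S X :
  is_subcat D -> D S -> add_of S X -> D X.
Proof.
move=> sD DS [n [T [dT XT]]]; apply: subcat_summand XT _ => //.
exact: subcat_dsum dT _.
Qed.

End Factors.

(** * Cotorsion pairs and a criterion for them to be tilting *)

Section Tilting.
Context {k : fieldType} {C : linCat k}.
Context (abC : abelian C) (epC : enough_projectives C) (eiC : enough_injectives C).
Implicit Types X Y S : C.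
Implicit Types U V T : set C.

Lemma left_perp1_subcat V : is_subcat (left_perp1 V).
Proof.
split.
- move=> X Y XY UX Z VZ; apply/Ext1P => //.
  by apply: ext1_summand (iso_retract XY) _ => //; apply/Ext1P => //; apply: UX.
- move=> n X S XS UX Z VZ; apply/Ext1P => //.
  by apply: ext1_dsum XS _ => // i; apply/Ext1P => //; apply: UX.
- move=> X S XS US Z VZ; apply/Ext1P => //.
  apply: ext1_summand (summand_retract XS) _ => //.
  by apply/Ext1P => //; apply: US.
Qed.

Section Cotorsion.
Context {U V : set C}.
Hypothesis UV : cotorsion_pair U V.

Lemma cotorsion_ext1 X Y : U X -> V Y -> ext1 X Y.
Proof. by move=> UX VY; apply/Ext1P => //; apply: (cotorsion_Ext1 UV). Qed.

(** The cover sequence of [X] splits, so [X] is a retract of its middle term. Dually,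
    [cotorsion_right] splits a hull. *)
Lemma cotorsion_left X : (forall Y, V Y -> ext1 X Y) -> U X.
Proof.
move=> H; have [V' [U' [f [g [fg UU' VV']]]]] := cotorsion_cover UV X.
have [s gs] := H _ VV' _ _ _ fg.
by apply: (subcat_retract abC (cotorsion_subcatl UV) _ UU'); exists s, g.
Qed.

Lemma cotorsion_right Y : (forall X, U X -> ext1 X Y) -> V Y.
Proof.
move=> H; have [V' [U' [f [g [fg VV' UU']]]]] := cotorsion_hull UV Y.
have [s /(ses_retraction fg)[r rf]] := H _ UU' _ _ _ fg.
by apply: (subcat_retract abC (cotorsion_subcatr UV) _ VV'); exists f, r.
Qed.

Lemma projective_cotorsion P : projective P -> U P.
Proof. by move=> PP; apply: cotorsion_left => Y _; apply: projective_ext1. Qed.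

End Cotorsion.

(** In X -> D -> Z, a class of [X] in one degree is controlled by [D] in that degree and by [Z] in
    the next; the induction therefore keeps all degrees together. *)
Lemma vee_extz T (Y : C) : (forall n X, T X -> extz n X Y) ->
  forall n X, vee T X -> extz n X Y.
Proof.
move=> TY n X [m]; elim: m n X => [|m IH] n X /=; first exact: TY.
move=> [D [Z [f [g [fg TD TZ]]]]]; apply: (extz_sub abC epC eiC fg).
  exact: TY.
exact: IH.
Qed.

Lemma vee_pdz T n : (forall X, T X -> pdz n X) -> forall X, vee T X -> pdz n X.
Proof.
move=> Tn X [m]; elim: m X => [|m IH] X /=; first exact: Tn.
move=> [D [Z [f [g [fg TD TZ]]]]] Y; apply: (extz_sub abC epC eiC fg).
  exact: Tn.
by apply: pdzS => //; apply: IH.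
Qed.

Section TiltingCotorsion.
Context {U V : set C}.

Lemma tilting_extz n X Y : tilting_cotorsion_pair U V -> U X -> V Y -> extz n X Y.
Proof.
move=> UV UX VY.
have UX' : vee (U `&` V) X by rewrite -(tcp_left UV).
have VY' : right_perp (U `&` V) Y by rewrite -(tcp_right UV).
apply: vee_extz UX' => m Z TZ; apply/Ext_zeroP => //.
exact: (VY' m.+1 isT Z TZ).
Qed.

Lemma tilting_pdz : tilting_cotorsion_pair U V ->
  exists n, forall X, U X -> pdz n X.
Proof.
move=> UV; have [n [_ Tn]] := tcp_tilting UV; exists n => X UX.
have UX' : vee (U `&` V) X by rewrite -(tcp_left UV).
apply: vee_pdz UX' => Y TY.
by apply/pd_leP => //; apply: (tilting_P1 Tn).
Qed.

Section OfPd.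
Hypothesis UV : cotorsion_pair U V.
Hypothesis extUV : forall n X Y, U X -> V Y -> extz n X Y.

(** Passing from [X] to the cokernel of its hull lowers by one the degree in which Ext(U, -) is
    known to vanish. Once Ext^1 vanishes, the object lies in [V]. *)
Lemma cotorsion_vee_n n X : U X -> (forall W, U W -> extz n W X) ->
  vee_n (U `&` V) n X.
Proof.
elim: n X => [|n IH] X UX H /=; first by split=> //; apply: (cotorsion_right UV).
have [V' [U' [f [g [fg VV' UU']]]]] := cotorsion_hull UV X.
have UV' : U V'.
  apply: (cotorsion_left UV) => Y VY.
  by apply: (extz_extension abC epC eiC fg (n := 0)); apply: (extUV 0).
exists V', U', f, g; split=> //; apply: IH => // W UW.
by apply: (extz_quotr abC epC eiC fg); [apply: extUV|apply: H].
Qed.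

Lemma tilting_of_pdz n : (0 < n)%N -> (forall X, U X -> pdz n X) ->
  tilting_cotorsion_pair U V.
Proof.
move=> n0 pdU.
have Uvee X : U X -> vee_n (U `&` V) n X.
  by move=> UX; apply: cotorsion_vee_n => // W /pdU; apply.
have extT m X Y : (U `&` V) X -> V Y -> Ext_zero m.+1 X Y.
  by move=> [UX _] VY; apply/Ext_zeroP => //; apply: extUV.
have sT := subcat_setI (cotorsion_subcatl UV) (cotorsion_subcatr UV).
have eqU : U = vee (U `&` V).
  apply/seteqP; split=> X; first by move=> /Uvee; exists n.
  move=> XT; apply: (cotorsion_left UV) => Y VY.
  suff: extz 0 X Y by [].
  by apply: vee_extz XT => m Z [UZ _]; apply: extUV.
split=> //.
- by move=> X Y UX VY; apply/Ext_zeroP => //; apply: extUV.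
(* The same [n] bounds the projective dimension and the length of the coresolutions; its positivity
   is required of a generalized tilting subcategory. *)
- exists n; split=> //; split=> //.
  + by move=> X [UX _]; apply/pd_leP => //; apply: pdU.
  + by case=> // i _ X Y TX [_ VY]; apply: extT.
  + by move=> P PP; apply/Uvee/(projective_cotorsion UV).
- apply/seteqP; split=> Y.
    by move=> VY [//|m] _ X TX; apply: extT.
  (* Orthogonality to the tilting subcategory in all degrees passes to its coresolved objects, which
     are all of [U]. *)
  move=> TY; apply: (cotorsion_right UV) => X; rewrite eqU => XT.
  suff: extz 0 X Y by [].
  apply: vee_extz XT => m Z TZ; apply/Ext_zeroP => //.
  exact: (TY m.+1 isT Z TZ).
Qed.

End OfPd.
End TiltingCotorsion.
End Tilting.

(** * Further facts on pushouts and extensions *)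

Section MoreAbelian.
Context {k : fieldType} {C : linCat k} (abC : abelian C).
Implicit Types X Y Z P : C.

Lemma isomorphic_trans X Y Z : isomorphic X Y -> isomorphic Y Z -> isomorphic X Z.
Proof.
move=> [f [f' [e1 e2]]] [g [g' [e3 e4]]]; exists (g ∘ f), (f' ∘ g'); split.
  by rewrite -cmpA (cmpA g') e3 cmp1m.
by rewrite -cmpA (cmpA f) e2 cmp1m.
Qed.

Lemma ses_zeror_iso X Y Z (f : hom C X Y) (g : hom C Y Z) :
  ses f g -> is_zero Z -> is_iso f.
Proof.
move=> fg [_ Z0]; apply: epi_mono_iso => //; last exact: ses_mono fg.
by apply/epi0P => W u /(ses_desc fg)[v <-]; rewrite (Z0 _ g) cmpm0.
Qed.

Lemma pushout_sym X Y Z P (f : hom C X Y) (g : hom C X Z) (a : hom C Y P)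
    (b : hom C Z P) : is_pushout f g a b -> is_pushout g f b a.
Proof.
move=> [ab H]; split=> // W u v uv; have [|w [[w1 w2] wu]] := H W v u => //.
by exists w; split=> // w' [w1' w2']; apply: wu.
Qed.

Lemma pushout_iso X Y Z P (f : hom C X Y) (g : hom C X Z) (a : hom C Y P)
    (b : hom C Z P) : is_pushout f g a b -> is_iso g -> is_iso a.
Proof.
move=> [ab H] [g' [g'g gg']].
have [|w [[wa wb] _]] := H Y (idm Y) (f ∘ g').
  by rewrite cmp1m -cmpA g'g cmpm1.
exists w; split=> //; have [//|t [_ tu]] := H P a b.
rewrite -(tu (idm P)); last by rewrite !cmp1m.
apply/esym/tu; rewrite -!cmpA wa wb cmpm1; split=> //.
by rewrite cmpA ab -cmpA gg' cmpm1.
Qed.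

Context (epC : enough_projectives C).

(** To extend [f] from the syzygy [W] to [P], extend [p ∘ f] and lift the result to [h]; the error
    of [h] on [W] lands in Y', where it extends too. *)
Lemma ext1_extensionr X Y' Y Y'' (i : hom C Y' Y) (p : hom C Y Y'') :
  ses i p -> ext1 X Y' -> ext1 X Y'' -> ext1 X Y.
Proof.
move=> ip XY' XY''; have [W [P [w [q [PP wq]]]]] := proj_presentation abC epC X.
apply: (proj_extend_ext1 PP wq) => f.
have [g gw] := ext1_extend abC (p ∘ f) XY'' wq.
have [h ph] := PP _ _ _ g (ses_epi ip).
have [|u iu] := @ses_lift _ _ _ _ _ _ _ ip _ (f - h ∘ w).
  by rewrite cmpBr cmpA ph gw subrr.
have [v vw] := ext1_extend abC u XY' wq; exists (i ∘ v + h).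
by rewrite cmpDl -cmpA vw iu subrK.
Qed.

(* Salce's trick: push out a projective presentation of [X] along a hull of its
   syzygy [L]. *)
Lemma hull_cover (X L P V F : C) (l : hom C L P) (p : hom C P X)
    (f : hom C L V) (g : hom C V F) : ses l p -> ses f g ->
  exists (E : C) (b : hom C V E) (q : hom C E X) (a : hom C P E) (c : hom C E F),
    ses b q /\ ses a c.
Proof.
move=> lp fg; have [E [a [b [q [po bq _]]]]] := ses_pushout abC f lp.
have [c [ac _]] := pushout_ses abC fg (pushout_sym po).
by exists E, b, q, a, c.
Qed.

End MoreAbelian.

(** * Adjunctions *)

Section Functor.
Context {k : fieldType} {C D : linCat k} (F : functor C D).
Implicit Types X Y Z S : C.

Lemma fmap0 X Y : fmap F (0 : hom C X Y) = 0.
Proof. by apply: (addrI (fmap F 0)); rewrite -fmapD !addr0. Qed.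

Lemma fmap_sum (I : finType) X Y (f : I -> hom C X Y) :
  fmap F (\sum_i f i) = \sum_i fmap F (f i).
Proof. by apply: (big_morph _ (@fmapD _ _ _ F X Y)); apply: fmap0. Qed.

Lemma fmap_iso X Y (f : hom C X Y) : is_iso f -> is_iso (fmap F f).
Proof.
by move=> [g [gf fg]]; exists (fmap F g); rewrite -!fmap_cmp gf fg !fmap1.
Qed.

Lemma fmap_retract X Y : retract X Y -> retract (F X) (F Y).
Proof.
by move=> [s [r rs]]; exists (fmap F s), (fmap F r); rewrite -fmap_cmp rs fmap1.
Qed.

Lemma fmap_dsum (I : finType) (X : I -> C) S :
  dsum X S -> dsum (fun i => F (X i)) (F S).
Proof.
move=> [inj [prj [e1 e2 e3]]].
exists (fun i => fmap F (inj i)), (fun i => fmap F (prj i)); split=> [i|i j ij|].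
- by rewrite -fmap_cmp e1 fmap1.
- by rewrite -fmap_cmp e2 // fmap0.
- by rewrite -fmap1 -e3 fmap_sum; apply: eq_bigr => i _; rewrite fmap_cmp.
Qed.

Lemma fmap_factors S X : factors S (idm X) -> factors (F S) (idm (F X)).
Proof.
move=> [I [f [g e]]]; exists I, (fun i => fmap F (f i)), (fun i => fmap F (g i)).
by rewrite -fmap1 -e fmap_sum; apply: eq_bigr => i _; rewrite fmap_cmp.
Qed.

Lemma exact_epi X Y (f : hom C X Y) :
  abelian C -> exact_functor F -> epi f -> epi (fmap F f).
Proof. by move=> abC exF /(ses_of_epi abC)[K [i /exF/ses_epi]]. Qed.

Lemma exact_mono X Y (f : hom C X Y) :
  abelian C -> exact_functor F -> mono f -> mono (fmap F f).
Proof. by move=> abC exF /(ses_of_mono abC)[K [i /exF/ses_mono]]. Qed.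

Lemma ff_faithful : fully_faithful F ->
  forall X Y (f g : hom C X Y), fmap F f = fmap F g -> f = g.
Proof. by move=> ffF X Y f g; apply: (bij_inj (ffF X Y)). Qed.

Lemma ff_full : fully_faithful F ->
  forall X Y (f : hom D (F X) (F Y)), exists g, fmap F g = f.
Proof. by move=> ffF X Y f; have [h _ fK] := ffF X Y; exists (h f); apply: fK. Qed.

End Functor.

Section Adjunction.
Context {k : fieldType} {C D : linCat k}.
Context {L : functor C D} {R : functor D C} (adj : adjunction L R).

Definition adj_l X Y (f : hom D (L X) Y) : hom C X (R Y) :=
  fmap R f ∘ adj_unit adj X.
Definition adj_r X Y (g : hom C X (R Y)) : hom D (L X) Y :=
  adj_counit adj Y ∘ fmap L g.

Lemma adj_lK X Y (f : hom D (L X) Y) : adj_r (adj_l f) = f.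
Proof.
by rewrite /adj_r /adj_l fmap_cmp cmpA -counit_nat -cmpA triangleL cmpm1.
Qed.

Lemma adj_rK X Y (g : hom C X (R Y)) : adj_l (adj_r g) = g.
Proof.
by rewrite /adj_r /adj_l fmap_cmp -cmpA -unit_nat cmpA triangleR cmp1m.
Qed.

Lemma adj_l_cmpl X Y Z (h : hom D Y Z) (f : hom D (L X) Y) :
  adj_l (h ∘ f) = fmap R h ∘ adj_l f.
Proof. by rewrite /adj_l fmap_cmp cmpA. Qed.

Lemma adj_l_cmpr X Y Z (f : hom D (L Y) Z) (g : hom C X Y) :
  adj_l (f ∘ fmap L g) = adj_l f ∘ g.
Proof. by rewrite /adj_l fmap_cmp -cmpA -unit_nat cmpA. Qed.

Lemma adj_r_cmpl X Y Z (h : hom D Y Z) (g : hom C X (R Y)) :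
  adj_r (fmap R h ∘ g) = h ∘ adj_r g.
Proof. by rewrite /adj_r fmap_cmp cmpA -counit_nat cmpA. Qed.

Lemma adj_r_cmpr X Y Z (g : hom C Y (R Z)) (f : hom C X Y) :
  adj_r (g ∘ f) = adj_r g ∘ fmap L f.
Proof. by rewrite /adj_r fmap_cmp cmpA. Qed.

Lemma adj_l0 X Y : adj_l (0 : hom D (L X) Y) = 0.
Proof. by rewrite /adj_l fmap0 cmp0m. Qed.

Lemma adj_r0 X Y : adj_r (0 : hom C X (R Y)) = 0.
Proof. by rewrite /adj_r fmap0 cmpm0. Qed.

Lemma ladj_epi X Y (f : hom C X Y) : epi f -> epi (fmap L f).
Proof.
move=> /epi0P fe; apply/epi0P => Z u uf0.
by rewrite -[u]adj_lK (fe _ (adj_l u)) ?adj_r0 // -adj_l_cmpr uf0 adj_l0.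
Qed.

Lemma radj_mono X Y (f : hom D X Y) : mono f -> mono (fmap R f).
Proof.
move=> /mono0P fm; apply/mono0P => Z u fu0.
by rewrite -[u]adj_rK (fm _ (adj_r u)) ?adj_l0 // -adj_r_cmpl fu0 adj_r0.
Qed.

Lemma ladj_cokernel X Y Z (f : hom C X Y) (g : hom C Y Z) :
  is_cokernel f g -> is_cokernel (fmap L f) (fmap L g).
Proof.
move=> fg; apply: cok_intro.
- by rewrite -fmap_cmp (cok_eq0 fg) fmap0.
- exact: ladj_epi (cok_epi fg).
- move=> W u uf0; have [|v vg] := @cok_fac _ _ _ _ _ _ _ _ (adj_l u) fg.
    by rewrite -adj_l_cmpr uf0 adj_l0.
  by exists (adj_r v); rewrite -adj_r_cmpr vg adj_lK.
Qed.

Lemma radj_kernel X Y Z (f : hom D X Y) (g : hom D Y Z) :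
  is_kernel f g -> is_kernel (fmap R f) (fmap R g).
Proof.
move=> fg; apply: ker_intro.
- by rewrite -fmap_cmp (ker_eq0 fg) fmap0.
- exact: radj_mono (ker_mono fg).
- move=> W u gu0; have [|v fv] := @ker_fac _ _ _ _ _ _ _ _ (adj_r u) fg.
    by rewrite -adj_r_cmpl gu0 adj_r0.
  by exists (adj_l v); rewrite -adj_l_cmpl fv adj_rK.
Qed.

Lemma ladj_pushout X Y Z P (f : hom C X Y) (g : hom C X Z) (a : hom C Y P)
    (b : hom C Z P) : is_pushout f g a b ->
  is_pushout (fmap L f) (fmap L g) (fmap L a) (fmap L b).
Proof.
move=> [ab H]; split=> [|W u v uv]; first by rewrite -!fmap_cmp ab.
have [|w [[wa wb] wu]] := H _ (adj_l u) (adj_l v).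
  by rewrite -!adj_l_cmpr uv.
exists (adj_r w); split=> [|w' [wa' wb']].
  by rewrite -!adj_r_cmpr wa wb !adj_lK.
by rewrite -[RHS]adj_lK (wu (adj_l w')) // -!adj_l_cmpr wa' wb'.
Qed.

Lemma ladj_projective P : (forall Y Z (e : hom D Y Z), epi e -> epi (fmap R e)) ->
  projective P -> projective (L P).
Proof.
move=> Re PP Y Z e f /Re ee; have [h eh] := PP _ _ _ (adj_l f) ee.
by exists (adj_r h); rewrite -adj_r_cmpl eh adj_lK.
Qed.

Lemma radj_injective I : (forall Y Z (m : hom C Y Z), mono m -> mono (fmap L m)) ->
  injective_obj I -> injective_obj (R I).
Proof.
move=> Lm II Y Z m f /Lm mm; have [h hm] := II _ _ _ (adj_r f) mm.
by exists (adj_l h); rewrite -adj_l_cmpr hm adj_rK.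
Qed.

(** The transpose of an epimorphism from a projective onto [R Y] is again epi, because [R] is
    faithful. *)
Lemma ladj_enough_projectives :
  (forall Y Z (f g : hom D Y Z), fmap R f = fmap R g -> f = g) ->
  (forall Y Z (e : hom D Y Z), epi e -> epi (fmap R e)) ->
  enough_projectives C -> enough_projectives D.
Proof.
move=> Rf Re epC Y; have [P [p [PP pe]]] := epC (R Y).
exists (L P), (adj_r p); split; first exact: ladj_projective.
move=> Z u v uv; apply: Rf; apply: pe.
by rewrite -[p]adj_rK -!adj_l_cmpl uv.
Qed.

Lemma radj_enough_injectives :
  (forall Y Z (f g : hom C Y Z), fmap L f = fmap L g -> f = g) ->
  (forall Y Z (m : hom C Y Z), mono m -> mono (fmap L m)) ->
  enough_injectives D -> enough_injectives C.
Proof.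
move=> Lf Lm eiD X; have [I [j [II jm]]] := eiD (L X).
exists (R I), (adj_l j); split; first exact: radj_injective.
move=> Z u v uv; apply: Lf; apply: jm.
by rewrite -[j]adj_lK -!adj_r_cmpr uv.
Qed.

Lemma unit_iso X : fully_faithful L -> is_iso (adj_unit adj X).
Proof.
move=> ffL; have [h hc] := ff_full ffL (adj_counit adj (L X)).
exists h; split.
  by apply: (ff_faithful ffL); rewrite fmap_cmp hc triangleL fmap1.
by rewrite unit_nat hc triangleR.
Qed.

Lemma counit_iso Y : fully_faithful R -> is_iso (adj_counit adj Y).
Proof.
move=> ffR; have [h hu] := ff_full ffR (adj_unit adj (R Y)).
exists h; split; first by rewrite counit_nat hu triangleL.
by apply: (ff_faithful ffR); rewrite fmap_cmp hu triangleR fmap1.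
Qed.

(** [L] carries a projective presentation of [X] to one of [L X]: it is exact, and it preserves
    projectives because [R] preserves epimorphisms. *)
Lemma ladj_extz n X Y : abelian C -> enough_projectives C ->
  abelian D -> enough_projectives D -> enough_injectives D ->
  exact_functor L -> (forall Y Z (e : hom D Y Z), epi e -> epi (fmap R e)) ->
  extz n X (R Y) -> extz n (L X) Y.
Proof.
move=> abC epC abD epD eiD exL Re; elim: n X => [|n IH] X XY;
  have [W [P [w [p [PP wp]]]]] := proj_presentation abC epC X;
  have LPP := ladj_projective Re PP; have Lwp := exL _ _ _ _ _ wp.
  apply: (proj_extend_ext1 LPP Lwp) => f.
  have [h hw] := ext1_extend abC (adj_l f) XY wp.
  by exists (adj_r h); rewrite -adj_r_cmpr hw adj_lK.
apply/(extz_syzygy abD epD eiD n Y LPP Lwp)/IH.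
exact: XY PP wp.
Qed.

End Adjunction.

(** * Recollements *)

Section Recollement.
Context {k : fieldType} {A B C : linCat k}.
Context (abA : abelian A) (abB : abelian B) (abC : abelian C).
Context (r : recollement A B C).
Context (exact_ish : exact_functor (i_sh r)).

Lemma ils_exact : exact_functor (i_ls r).
Proof.
move=> X Y Z f g [kf cg]; split; first exact: (radj_kernel (adj_ius_ils r) kf).
exact: (ladj_cokernel (adj_ils_ish r) cg).
Qed.

Lemma jus_exact : exact_functor (j_us r).
Proof.
move=> X Y Z f g [kf cg]; split; first exact: (radj_kernel (adj_jsh_jus r) kf).
exact: (ladj_cokernel (adj_jus_jls r) cg).
Qed.

Lemma jus_ils_zero X : is_zero (j_us r (i_ls r X)).
Proof. by apply/im_ils_ker_jus; exists X; apply: isomorphic_refl. Qed.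

(** The transpose of [f] starts at j^* i_* X, which is zero. *)
Lemma hom_ils_jls0 X Y (f : hom B (i_ls r X) (j_ls r Y)) : f = 0.
Proof.
have [j0 _] := jus_ils_zero X; rewrite -(adj_rK (adj_jus_jls r) f).
by rewrite (j0 _ (adj_r _ f)) adj_l0.
Qed.

Lemma ish_jls_zero Y : is_zero (i_sh r (j_ls r Y)).
Proof.
apply/zeroP; rewrite -(adj_rK (adj_ils_ish r) (idm _)).
by rewrite (hom_ils_jls0 (adj_r _ _)) adj_l0.
Qed.

(** If j^* Y = 0 then some isomorphism i_* W -> Y exists; its transpose W -> i^! Y is zero, hence so
    is the isomorphism. *)
Lemma jus_ish_zero Y : is_zero (j_us r Y) -> is_zero (i_sh r Y) -> is_zero Y.
Proof.
move=> /im_ils_ker_jus[W [f [g [_ fg]]]] [_ Y0]; apply/zeroP.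
rewrite -fg -(adj_lK (adj_ils_ish r) f).
by rewrite (Y0 _ (adj_l _ f)) adj_r0 cmp0m.
Qed.

(** The cokernel of [f] is killed by j^*, and exactness of i^! makes its image under i^! a quotient
    of i^! j_* Y = 0. *)
Lemma to_jls_epi X Y (f : hom B X (j_ls r Y)) : epi (fmap (j_us r) f) -> epi f.
Proof.
move=> jfe; have [Q [q cq]] := abelian_coker abB f.
have [_ Q0] : is_zero Q.
  apply: jus_ish_zero.
    have jq0 : fmap (j_us r) q = 0.
      by apply: jfe; rewrite -fmap_cmp (cok_eq0 cq) fmap0 cmp0m.
    apply/zeroP; apply: (ladj_epi (adj_jus_jls r) (cok_epi cq)).
    by rewrite jq0 !cmpm0.
  exact: zero_epi (ish_jls_zero Y) (exact_epi abB exact_ish (cok_epi cq)).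
by apply/epi0P => W u /(cok_fac cq)[v <-]; rewrite (Q0 _ q) cmpm0.
Qed.

Lemma jls_epi X Y (e : hom C X Y) : epi e -> epi (fmap (j_ls r) e).
Proof.
move=> ee; apply: to_jls_epi.
apply: (iso_cmp_epi (counit_iso (adj_jus_jls r) Y (ff_jls r))).
by rewrite -counit_nat; apply: epi_cmp ee (iso_epi (counit_iso _ _ (ff_jls r))).
Qed.

Lemma jls_exact : exact_functor (j_ls r).
Proof.
move=> X Y Z f g fg; have kF := radj_kernel (adj_jus_jls r) fg.1.
by split=> //; apply: epi_ker_cok kF => //; apply: jls_epi (ses_epi fg).
Qed.

Let eta Y := adj_unit (adj_jus_jls r) Y.
Let eps Y := adj_counit (adj_ils_ish r) Y.

Lemma jus_unit_iso Y : is_iso (fmap (j_us r) (eta Y)).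
Proof.
have tri := triangleL (adj_jus_jls r) Y.
have [c [ce ec]] := counit_iso (adj_jus_jls r) (j_us r Y) (ff_jls r).
rewrite (_ : fmap _ _ = c); first by exists (adj_counit (adj_jus_jls r) (j_us r Y)).
by rewrite -[LHS]cmp1m -ce -cmpA tri cmpm1.
Qed.

Lemma counit_unit_ses Y : ses (eps Y) (eta Y).
Proof.
have ee : epi (eta Y) by apply/to_jls_epi/iso_epi/jus_unit_iso.
have [N [n kn]] := abelian_ker abB (eta Y).
suff ke : is_kernel (eps Y) (eta Y) by split=> //; apply: epi_ker_cok.
(* j^* turns the unit into an isomorphism, so it kills the kernel [N], which then comes from [A];
   hence [n] factors through the counit. *)
have [W [f [g [gf fg]]]] : exists W, isomorphic (i_ls r W) N.
  apply/im_ils_ker_jus/zeroP; have kjn := radj_kernel (adj_jsh_jus r) kn.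
  apply: (ker_mono kjn); apply: (iso_mono (jus_unit_iso Y)).
  by rewrite cmpA (ker_eq0 kjn) cmp0m !cmpm0.
have ke0 : eta Y ∘ eps Y = 0 by apply: hom_ils_jls0.
have [t nt] := ker_fac kn ke0.
pose m := fmap (i_ls r) (adj_l (adj_ils_ish r) (n ∘ f)).
have em : eps Y ∘ m ∘ g = n.
  by rewrite [eps Y ∘ m](adj_lK (adj_ils_ish r)) -cmpA fg cmpm1.
(* The comparison endomorphism of i_* i^! Y equals i_* w, and transposing across the counit gives w
   = 1. So [t] is split monic and the counit is monic. *)
have [w ew] := ff_full (ff_ils r) (m ∘ g ∘ t).
have w1 : w = idm _.
  rewrite -(adj_rK (adj_ils_ish r) w) -[RHS](adj_rK (adj_ils_ish r)).
  by congr adj_l; rewrite /adj_r ew fmap1 cmpm1 !cmpA em nt.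
apply: ker_intro => //.
  rewrite -nt; apply: mono_cmp (ker_mono kn) _.
  by apply: (@section_mono _ _ _ _ (m ∘ g)); rewrite -ew w1 fmap1.
by move=> X u /(ker_fac kn)[v <-]; exists (m ∘ g ∘ v); rewrite !cmpA em.
Qed.

(** * Projectives, injectives and Ext across the recollement *)

Context (exact_jsh : exact_functor (j_sh r)).
Context (epB : enough_projectives B) (eiB : enough_injectives B).

Lemma epA : enough_projectives A.
Proof.
apply: (ladj_enough_projectives (adj_ius_ils r)) epB.
  exact: ff_faithful (ff_ils r).
by move=> Y Z e; apply: exact_epi ils_exact.
Qed.

(** Projectives come from [B] through j^*, which preserves them because its right adjoint j_*
    preserves epimorphisms. *)
Lemma epC : enough_projectives C.
Proof.
apply: (ladj_enough_projectives (adj_jus_jls r)) epB.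
  exact: ff_faithful (ff_jls r).
exact: jls_epi.
Qed.

Lemma eiA : enough_injectives A.
Proof.
apply: (radj_enough_injectives (adj_ils_ish r)) eiB.
  exact: ff_faithful (ff_ils r).
by move=> Y Z e; apply: exact_mono ils_exact.
Qed.

Lemma eiC : enough_injectives C.
Proof.
apply: (radj_enough_injectives (adj_jsh_jus r)) eiB.
  exact: ff_faithful (ff_jsh r).
by move=> Y Z e; apply: exact_mono exact_jsh.
Qed.

Lemma ils_extz n X Y : extz n X (i_sh r Y) -> extz n (i_ls r X) Y.
Proof.
apply: (ladj_extz (adj_ils_ish r) abA epA abB epB eiB ils_exact).
by move=> Y' Z e; apply: exact_epi exact_ish.
Qed.

Lemma jsh_extz n X Y : extz n X (j_us r Y) -> extz n (j_sh r X) Y.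
Proof.
apply: (ladj_extz (adj_jsh_jus r) abC epC abB epB eiB exact_jsh).
by move=> Y' Z e; apply: exact_epi jus_exact.
Qed.

(** * The pushout that changes i^! Y and keeps j^* Y *)

Section GluePushout.
Context {Y : B} {V U : A} {f : hom A (i_sh r Y) V} {g : hom A V U}.
Context {K : B} {a : hom B Y K} {b : hom B (i_ls r V) K}.
Hypotheses (fg : ses f g) (po : is_pushout (eps Y) (fmap (i_ls r) f) a b).

Lemma glue_ses_ils : exists q : hom B K (i_ls r U), ses a q.
Proof.
have [q [aq _]] := pushout_ses abB (ils_exact fg) (pushout_sym po).
by exists q.
Qed.

Lemma glue_ses_jls : exists p : hom B K (j_ls r (j_us r Y)), ses b p.
Proof. by have [p [bp _]] := pushout_ses abB (counit_unit_ses Y) po; exists p. Qed.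

(** Apply the exact functor i^! to i_* V -> K -> j_* j^* Y: the last term vanishes and i^! i_* V is
    [V]. *)
Lemma glue_ish : isomorphic V (i_sh r K).
Proof.
have [p /exact_ish bp] := glue_ses_jls.
apply: (@isomorphic_trans _ _ _ (i_sh r (i_ls r V))).
  by exists (adj_unit (adj_ils_ish r) V); apply: unit_iso (ff_ils r).
by exists (fmap (i_sh r) b); apply: ses_zeror_iso bp (ish_jls_zero _).
Qed.

Lemma glue_jus : isomorphic (j_us r Y) (j_us r K).
Proof.
have [q /jus_exact aq] := glue_ses_ils.
by exists (fmap (j_us r) a); apply: ses_zeror_iso aq (jus_ils_zero _).
Qed.

End GluePushout.

(** * The glued pair is a tilting cotorsion pair *)

Context {U1 V1 : set A} {U3 V3 : set C}.
Context (tcp1 : tilting_cotorsion_pair U1 V1).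
Context (tcp3 : tilting_cotorsion_pair U3 V3).

Let cp1 := tcp_cotorsion tcp1.
Let cp3 := tcp_cotorsion tcp3.
Let sV1 := cotorsion_subcatr cp1.
Let sV3 := cotorsion_subcatr cp3.
Local Notation V2 := (glued_V r V1 V3).
Local Notation U2 := (glued_U r V1 V3).

Lemma glued_V_subcat : is_subcat V2.
Proof.
split.
- move=> X Y /iso_retract XY [VX1 VX3]; split.
    exact: (subcat_retract abA sV1 (fmap_retract (i_sh r) XY)).
  exact: (subcat_retract abC sV3 (fmap_retract (j_us r) XY)).
- move=> n X S XS H; split.
    by apply: (subcat_dsum sV1 (fmap_dsum (i_sh r) XS)) => i; case: (H i).
  by apply: (subcat_dsum sV3 (fmap_dsum (j_us r) XS)) => i; case: (H i).
- move=> X Y /summand_retract XY [VX1 VX3]; split.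
    exact: (subcat_retract abA sV1 (fmap_retract (i_sh r) XY)).
  exact: (subcat_retract abC sV3 (fmap_retract (j_us r) XY)).
Qed.

Lemma ils_glued_V X : V1 X -> V2 (i_ls r X).
Proof.
move=> VX; split; last by apply: subcat_zero sV3 (jus_ils_zero X).
apply: (subcat_iso sV1) VX.
by exists (adj_unit (adj_ils_ish r) X); apply: unit_iso (ff_ils r).
Qed.

Lemma jls_glued_V X : V3 X -> V2 (j_ls r X).
Proof.
move=> VX; split; first by apply: subcat_zero sV1 (ish_jls_zero X).
apply: (subcat_iso sV3) VX; apply: isomorphic_sym.
by exists (adj_counit (adj_jus_jls r) X); apply: counit_iso (ff_jls r).
Qed.

Lemma ils_glued_extz n X Y : U1 X -> V2 Y -> extz n (i_ls r X) Y.
Proof. by move=> UX [VY _]; apply/ils_extz/(tilting_extz abA epA eiA _ tcp1). Qed.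

Lemma jsh_glued_extz n X Y : U3 X -> V2 Y -> extz n (j_sh r X) Y.
Proof. by move=> UX [_ VY]; apply/jsh_extz/(tilting_extz abC epC eiC _ tcp3). Qed.

Lemma glued_ext1P X : U2 X <-> forall Y, V2 Y -> ext1 X Y.
Proof. by split=> H Y /H; move/(Ext1P abB epB). Qed.

Lemma glued_hull X : exists (V F : B) (U : C) (W : A) (f : hom B X V)
    (g : hom B V F) (u : hom B (j_sh r U) F) (v : hom B F (i_ls r W)),
  [/\ ses f g, ses u v, V2 V, U3 U & U1 W].
Proof.
have [V [U [h [g [hg VV UU]]]]] := cotorsion_hull cp3 (j_us r X).
pose c := adj_counit (adj_jsh_jus r) X.
have [X' [a [b [q [po bq _]]]]] := ses_pushout abB c (exact_jsh hg).
(* By a triangle identity this is inverse to the unit at j^* X, an isomorphism since j_! is fully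
   faithful. Hence j^* of the pushout X' is [V]. *)
have ic : is_iso (fmap (j_us r) c).
  have [e [eu ue]] := unit_iso (adj_jsh_jus r) (j_us r X) (ff_jsh r).
  have tri := triangleR (adj_jsh_jus r) X.
  rewrite (_ : fmap _ _ = e); first by exists (adj_unit (adj_jsh_jus r) (j_us r X)).
  by rewrite -[LHS]cmpm1 -ue cmpA tri cmp1m.
have VX' : V3 (j_us r X').
  apply: (subcat_iso sV3) VV; apply: isomorphic_trans.
    by exists (adj_unit (adj_jsh_jus r) V); apply: unit_iso (ff_jsh r).
  by exists (fmap (j_us r) a); apply: pushout_iso (ladj_pushout (adj_jus_jls r) po) ic.
have [V' [U' [h' [g' [hg' VV' UU']]]]] := cotorsion_hull cp1 (i_sh r X').
have [K [a' [b' [po' _]]]] := pushout_exists abB (eps X') (fmap (i_ls r) h').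
have [q' aq'] := glue_ses_ils hg' po'.
have [F [d [u [v [bd uv]]]]] := ses_cmp abB bq aq'.
exists K, F, U, U', (a' ∘ b), d, u, v; split=> //; split.
  exact: (subcat_iso sV1 (glue_ish po') VV').
exact: (subcat_iso sV3 (glue_jus hg' po') VX').
Qed.

Lemma glued_pdz : exists n, forall (U : C) (W : A) (F : B) (u : hom B (j_sh r U) F)
  (v : hom B F (i_ls r W)), ses u v -> U3 U -> U1 W -> pdz n.+1 F.
Proof.
have [n1 pd1] := tilting_pdz abA epA eiA tcp1.
have [n3 pd3] := tilting_pdz abC epC eiC tcp3.
(* The maximum already bounds both ends of the extension; the successor in the statement makes the
   bound positive, as [tilting_of_pdz] demands. *)
exists (maxn n1 n3) => U W F u v uv UU UW Y.
apply: (extz_extension abB epB eiB uv).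
  apply/jsh_extz/(pdz_leq abC epC eiC (m := n3)); last exact: pd3.
  by rewrite leqW ?leq_maxr.
apply/ils_extz/(pdz_leq abA epA eiA (m := n1)); last exact: pd1.
by rewrite leqW ?leq_maxl.
Qed.

(** [glued_U] is defined by Ext^1 alone. The higher vanishing and the dimension bound are therefore
    recorded for the covers [E] and later inherited by their retracts. *)
Lemma glued_cover : exists n, forall X,
  exists (V E : B) (f : hom B V E) (g : hom B E X),
  [/\ ses f g, V2 V, forall m Y, V2 Y -> extz m E Y & pdz n.+1 E].
Proof.
have [n pdn] := glued_pdz; exists n => X.
have [L [P [l [p [PP lp]]]]] := proj_presentation abB epB X.
have [V [F [U [W [f [g [u [v [fg uv VV UU UW]]]]]]]]] := glued_hull L.
have [E [b [q [a [c [bq ac]]]]]] := hull_cover abB lp fg.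
exists V, E, b, q; split=> //.
  move=> m Y VY; apply: (extz_extension abB epB eiB ac).
    exact: projective_extz.
  apply: (extz_extension abB epB eiB uv).
    exact: jsh_glued_extz.
  exact: ils_glued_extz.
move=> Y; apply: (extz_extension abB epB eiB ac); first exact: projective_extz.
exact: (pdn _ _ _ _ _ uv UU UW).
Qed.

Lemma glued_tilting : tilting_cotorsion_pair U2 V2.
Proof.
have [n covn] := glued_cover.
have cp2 : cotorsion_pair U2 V2.
  split.
  - exact: left_perp1_subcat.
  - exact: glued_V_subcat.
  - by move=> X Y UX VY; apply: UX.
  - move=> X; have [V [E [f [g [fg VV EE _]]]]] := covn X.
    by exists V, E, f, g; split=> //; apply/glued_ext1P => Y; apply: (EE 0).
  - move=> X; have [V [F [U [W [f [g [u [v [fg uv VV UU UW]]]]]]]]] := glued_hull X.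
    exists V, F, f, g; split=> //; apply/glued_ext1P => Y VY.
    apply: (extz_extension abB epB eiB uv (n := 0)).
      exact: jsh_glued_extz.
    exact: ils_glued_extz.
(* The cover of an object of the left class splits. *)
have U2r X : U2 X -> exists E, [/\ retract X E,
    forall m Y, V2 Y -> extz m E Y & pdz n.+1 E].
  move=> /glued_ext1P UX; have [V [E [f [g [fg VV EE pdE]]]]] := covn X.
  by have [s gs] := UX _ VV _ _ _ fg; exists E; split=> //; exists s, g.
apply: (tilting_of_pdz abB epB eiB cp2 _ (ltn0Sn n)).
  move=> m X Y /U2r[E [XE EE _]] VY.
  by apply: (extz_summand abB epB eiB XE); apply: EE.
move=> X /U2r[E [XE _ pdE]] Y.
by apply: (extz_summand abB epB eiB XE); apply: pdE.
Qed.

(** To split an extension of j^* X, apply the exact functor j_* and lift the unit X -> j_* j^* X;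
    the transpose of the lift is a section. *)
Lemma jus_glued_U X : U2 X -> U3 (j_us r X).
Proof.
move=> /glued_ext1P UX; apply: (cotorsion_left abC cp3) => Y VY E i p ip.
have [g pg] := ext1_lift abB epB (eta X) (UX _ (jls_glued_V VY)) (jls_exact ip).
exists (adj_r (adj_jus_jls r) g); rewrite -adj_r_cmpl pg.
by rewrite /adj_r triangleL.
Qed.

Lemma glued_obj_tilting T K : U3 T -> V3 T -> is_glued_obj r U1 V1 T K ->
  U2 K /\ V2 K.
Proof.
move=> UT VT [V [U [f [g [a [b [fg VV UU po]]]]]]]; split.
  have [q aq] := glue_ses_ils fg po; apply/glued_ext1P => Y VY.
  apply: (extz_extension abB epB eiB aq (n := 0)).
    exact: jsh_glued_extz.
  exact: ils_glued_extz.
split; first exact: (subcat_iso sV1 (glue_ish po) VV).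
apply: (subcat_iso sV3) VT; apply: isomorphic_trans (glue_jus fg po).
by exists (adj_unit (adj_jsh_jus r) T); apply: unit_iso (ff_jsh r).
Qed.

Lemma glued_obj_factor X T K (s : hom C (j_us r X) T) (t : hom C T (j_us r X)) :
  U2 X -> V2 X -> U3 T -> V3 T -> is_glued_obj r U1 V1 T K ->
  exists (b : hom B X K) (a : hom B K X),
    eta X ∘ (a ∘ b) = fmap (j_ls r) (t ∘ s) ∘ eta X.
Proof.
move=> /glued_ext1P UX [VX _] UT VT gK.
have [/glued_ext1P UK _] := glued_obj_tilting UT VT gK.
case: gK => V [U [f [g [a' [b' [fg VV UU po]]]]]].
have [p bp] := glue_ses_jls po.
(* The sequence of [K] ends in j_* j^* j_! T, so the unit is used to identify T with j^* j_! T. *)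
have [u' [u'u uu']] := unit_iso (adj_jsh_jus r) T (ff_jsh r).
pose u := adj_unit (adj_jsh_jus r) T.
have [b pb] := ext1_lift abB epB (fmap (j_ls r) (u ∘ s) ∘ eta X)
  (UX _ (ils_glued_V VV)) bp.
have [a ea] := ext1_lift abB epB (fmap (j_ls r) (t ∘ u') ∘ p)
  (UK _ (ils_glued_V VX)) (counit_unit_ses X).
exists b, a; rewrite cmpA ea -cmpA pb cmpA -fmap_cmp.
by rewrite -cmpA (cmpA u') u'u cmp1m.
Qed.

(** * An additive generator of the glued tilting subcategory *)

Context {T1 : A} {T3 : C}.
Context (addT1 : U1 `&` V1 = add_of T1) (addT3 : U3 `&` V3 = add_of T3).
Context {m : nat} {T3l : 'I_m -> C} {K : 'I_m -> B} {KT3 S : B}.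
Context (dT3 : dsum T3l T3) (glK : forall l, is_glued_obj r U1 V1 (T3l l) (K l)).
Context (dK : dsum K KT3) (dS : dsum2 (i_ls r T1) KT3 S).

Lemma T1_tilting : U1 T1 /\ V1 T1.
Proof.
suff: (U1 `&` V1) T1 by [].
by rewrite addT1; apply/add_ofP/factors_retract/retract_refl.
Qed.

Lemma T3l_tilting l : U3 (T3l l) /\ V3 (T3l l).
Proof.
suff: (U3 `&` V3) (T3l l) by [].
by rewrite addT3; apply/add_ofP/factors_retract/(dsum_retract _ dT3).
Qed.

Lemma S_retract : retract (i_ls r T1) S /\ forall l, retract (K l) S.
Proof.
have [i1 [i2 [p1 [p2 [e1 e2 e3 e4 e5]]]]] := (dsum2P _ _ _).1 dS.
split=> [|l]; first by exists i1, p1.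
have [s [t ts]] := dsum_retract l dK; exists (i2 ∘ s), (t ∘ p2).
by rewrite -cmpA (cmpA p2) e2 cmp1m.
Qed.

Lemma glued_tilting_add : U2 `&` V2 = add_of S.
Proof.
have sUV := subcat_setI (left_perp1_subcat abB epB V2) glued_V_subcat.
have [rT1 rK] := S_retract.
apply/seteqP; split=> X; last first.
  apply: subcat_add_of => //; apply: (subcat_dsum2 sUV dS).
    have [UT VT] := T1_tilting; split; last exact: ils_glued_V.
    by apply/glued_ext1P => Y VY; apply: (@ils_glued_extz 0).
  apply: (subcat_dsum sUV dK) => l; have [UT VT] := T3l_tilting l.
  exact: glued_obj_tilting UT VT (glK l).
move=> [UX VX]; apply/add_ofP => //.
(* [P e] says that [e] is induced by an endomorphism of [X] factoring through copies of [S]. It is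
   additive in [e], so the identity of j^* X may be split into maps through the [T3l l]. *)
pose P e := exists2 e', factors S e' & eta X ∘ e' = fmap (j_ls r) e ∘ eta X.
have P0 : P 0 by exists 0; [apply: factors0|rewrite fmap0 cmpm0 cmp0m].
have PD e1 e2 : P e1 -> P e2 -> P (e1 + e2).
  move=> [f1 F1 h1] [f2 F2 h2]; exists (f1 + f2); first exact: factorsD.
  by rewrite fmapD cmpDl cmpDr h1 h2.
have [e Se he] : P (idm (j_us r X)).
  have /(add_ofP abC)[I [f [g <-]]] : add_of T3 (j_us r X).
    by rewrite -addT3; split; [apply: jus_glued_U|case: VX].
  apply: (big_ind P) => // c _; have [inj [prj [_ _ e3]]] := dT3.
  rewrite -[f c]cmpm1 -e3 cmp_sumr cmp_suml; apply: (big_ind P) => // l _.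
  have [UT VT] := T3l_tilting l.
  have [b [a ab]] := glued_obj_factor (prj l ∘ g c) (f c ∘ inj l) UX VX UT VT (glK l).
  exists (a ∘ b); first exact: factors_cmp (factors_retract (rK l)).
  by rewrite ab !cmpA.
rewrite fmap1 cmp1m in he.
(* The unit does not see 1 - e, which therefore factors through i_* i^! X. *)
have [|c ec] := @ses_lift _ _ _ _ _ _ _ (counit_unit_ses X) _ (idm X - e).
  by rewrite cmpBr he cmpm1 subrr.
have [V' [T' [f [p [fp UT VV]]]]] := cotorsion_cover cp1 (i_sh r X).
(* T' is an extension of i^! X by V', both in V1; being also in U1, it lies in add T1. *)
have VT : V1 T'.
  apply: (cotorsion_right abA cp1) => W UW.
  apply: (ext1_extensionr abA epA fp).
    exact: (cotorsion_ext1 abA epA cp1 UW VV).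
  by case: VX => VX _; apply: (cotorsion_ext1 abA epA cp1 UW VX).
(* Since [X] is left orthogonal to i_* V', the map [c] lifts to i_* T'; this places 1 - e among the
   maps factoring through [S]. *)
have [c' pc] := ext1_lift abB epB c
  ((glued_ext1P X).1 UX _ (ils_glued_V VV)) (ils_exact fp).
rewrite -[idm X](subrK e) -ec -pc cmpA; apply: factorsD => //.
apply/factors_cmp/(factors_trans (factors_retract rT1))/fmap_factors.
by apply/(add_ofP abA); rewrite -addT1.
Qed.

End Recollement.

Theorem theorem4p4 (k : fieldType) (A B C : linCat k)
    (abA : abelian A) (abB : abelian B) (abC : abelian C)
    (ksA : krull_schmidt A) (ksB : krull_schmidt B) (ksC : krull_schmidt C)
    (r : recollement A B C)
    (epB : enough_projectives B) (eiB : enough_injectives B)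
    (exact_ish : exact_functor (i_sh r)) (exact_jsh : exact_functor (j_sh r))
    (U1 V1 : set A) (U3 V3 : set C)
    (tcp1 : tilting_cotorsion_pair U1 V1)
    (tcp3 : tilting_cotorsion_pair U3 V3)
    (T1 : A) (T3 : C)
    (addT1 : U1 `&` V1 = add_of T1) (addT3 : U3 `&` V3 = add_of T3) :
  tilting_cotorsion_pair (glued_U r V1 V3) (glued_V r V1 V3) /\
  forall (m : nat) (T3l : 'I_m -> C) (K : 'I_m -> B) (KT3 S : B),
    (forall l, indecomposable (T3l l)) ->
    dsum T3l T3 ->
    (forall l, is_glued_obj r U1 V1 (T3l l) (K l)) ->
    dsum K KT3 ->
    dsum2 (i_ls r T1) KT3 S ->
    glued_U r V1 V3 `&` glued_V r V1 V3 = add_of S.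
Proof.
split.
  exact: (glued_tilting abA abB abC exact_ish exact_jsh epB eiB tcp1 tcp3).
move=> m T3l K KT3 S _ dT3 glK dK dS.
exact: (glued_tilting_add abA abB abC exact_ish exact_jsh epB eiB tcp1 tcp3
  addT1 addT3 dT3 glK dK dS).
Qed.
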